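(* Let $H$ be a $K$-bialgebra, let $A$ be an $H$-module-algebra, and let $\mathcal{C}(n)=\mathrm{CH}^n_{\mathrm{Hopf}}(A,A)=\mathrm{Hom}_X(A^{\otimes(n+2)},A)$ for $n\ge 1$. For $k,n_1,\dots,n_k\ge 1$, $N=n_1+\cdots+n_k$, $N_i=n_1+\cdots+n_i$ (with $N_0=0$), $f\in\mathcal{C}(k)$, $g_i\in\mathcal{C}(n_i)$ and $a_0,\dots,a_{N+1}\in A$, put $$\gamma(f;g_1,\dots,g_k)(a_{0,N+1})=f\bigl(a_0\otimes g_1(1\otimes a_{1,n_1}\otimes 1)\otimes\cdots\otimes g_i(1\otimes a_{N_{i-1}+1,N_i}\otimes 1)\otimes\cdots\otimes g_k(1\otimes a_{N_{k-1}+1,N_k}\otimes 1)\otimes a_{N+1}\bigr).$$ Let $\mathrm{Id}\in\mathcal{C}(1)$ be given by $\mathrm{Id}(a_0\otimes a_1\otimes a_2)=a_0a_1a_2$ and let $\pi\in\mathcal{C}(2)$ be given by $\pi(a_0\otimes a_1\otimes a_2\otimes a_3)=a_0a_1a_2a_3$. Then the data $\mathcal{C}=\{\mathcal{C}(n),\gamma,\mathrm{Id}\}$ forms an operad. Moreover, $\pi\in\mathcal{C}(2)$ is a multiplication on the operad $\mathcal{C}$.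
   Context: Conventions. $K$ is a fixed field; vector spaces and tensor products are over $K$. $H$ is a $K$-bialgebra (associative, unital, coassociative, counital) with counit $\varepsilon$ and Sweedler notation $\Delta(b)=\sum b_{(1)}\otimes b_{(2)}$, $\Delta^2(b)=\sum b_{(1)}\otimes b_{(2)}\otimes b_{(3)}$, etc. $A$ is an associative unital $K$-algebra with unit $1$. $A$ is an $H$-module-algebra: $A$ is an $H$-module with $b(a_1a_2)=\sum(b_{(1)}a_1)(b_{(2)}a_2)$ and $b(1)=\varepsilon(b)1$ for $b\in H$, $a_1,a_2\in A$. Write $a_{i,j}=a_i\otimes a_{i+1}\otimes\cdots\otimes a_j$ for $i\le j$. Crossed product algebra. $X=A\otimes A\otimes H$ with the associative unital multiplication $(a_1\otimes a_1'\otimes b^1)(a_2\otimes a_2'\otimes b^2)=\sum a_1(b^1_{(1)}a_2)\otimes(b^1_{(3)}a_2')a_1'\otimes b^1_{(2)}b^2$. $A$ is an $X$-module by $(a\otimes a'\otimes b)a_0=a(ba_0)a'$, and $A^{\otimes(n+2)}$ is an $X$-module by $(a\otimes a'\otimes b)(a_0\otimes\cdots\otimes a_{n+1})=\sum a(b_{(1)}a_0)\otimes b_{(2)}a_1\otimes\cdots\otimes b_{(n+1)}a_n\otimes(b_{(n+2)}a_{n+1})a'$. Operads. An operad $\mathcal{O}=\{\mathcal{O}(n),\gamma,\mathrm{Id}\}$ (non-$\Sigma$) consists of vector spaces $\mathcal{O}(n)$ ($n\ge1$), linear maps $\gamma:\mathcal{O}(k)\otimes\mathcal{O}(n_1)\otimes\cdots\otimes\mathcal{O}(n_k)\to\mathcal{O}(n_1+\cdots+n_k)$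 for $k,n_1,\dots,n_k\ge1$, and an element $\mathrm{Id}\in\mathcal{O}(1)$ such that: (1) for $f\in\mathcal{O}(k)$, $g_i\in\mathcal{O}(n_i)$, $N_i=n_1+\cdots+n_i$, $N=N_k$, $N_0=0$, and any $h_1,\dots,h_N$ in $\mathcal{O}$ (each homogeneous), $$\gamma(\gamma(f;g_1,\dots,g_k);h_1,\dots,h_N)=\gamma\bigl(f;\gamma(g_1;h_1,\dots,h_{N_1}),\dots,\gamma(g_i;h_{N_{i-1}+1},\dots,h_{N_i}),\dots,\gamma(g_k;h_{N_{k-1}+1},\dots,h_{N_k})\bigr);$$ (2) $\gamma(-;\mathrm{Id},\dots,\mathrm{Id}):\mathcal{O}(k)\to\mathcal{O}(k)$ is the identity map for each $k\ge1$. A multiplication on $\mathcal{O}$ is an element $m\in\mathcal{O}(2)$ with $\gamma(m;m,\mathrm{Id})=\gamma(m;\mathrm{Id},m)$. *)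

(* Defs.v *)
From HB Require Import structures.
From mathcomp Require Import all_boot all_order all_algebra.
From mathcomp Require Import boolp functions.

Set Implicit Arguments.
Unset Strict Implicit.
Unset Printing Implicit Defensive.

Import GRing.Theory.
Local Open Scope ring_scope.
Local Open Scope quotient_scope.

(* A formal sum of pure tensors [u_1 (x) v_1 + ... + u_r (x) v_r] is the list of
   the pairs [(u_i, v_i)]; scalars are absorbed in the left factors.
   [tensor_rel] is the congruence, for concatenation, generated by the
   defining relations of the tensor product. *)
Inductive tensor_rel (K : fieldType) (U V : lmodType K) :
    seq (U * V) -> seq (U * V) -> Prop :=
| TensorRefl s : tensor_rel s s
| TensorSym s t : tensor_rel s t -> tensor_rel t s
| TensorTrans s t r : tensor_rel s t -> tensor_rel t r -> tensor_rel s r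
| TensorCat s s' t t' :
    tensor_rel s s' -> tensor_rel t t' -> tensor_rel (s ++ t) (s' ++ t')
| TensorCatC s t : tensor_rel (s ++ t) (t ++ s)
| TensorDl u u' v : tensor_rel [:: (u + u', v)] [:: (u, v); (u', v)]
| TensorDr u v v' : tensor_rel [:: (u, v + v')] [:: (u, v); (u, v')]
| TensorZ k u v : tensor_rel [:: (k *: u, v)] [:: (u, k *: v)]
| Tensor0 v : tensor_rel [:: (0, v)] [::].

Section Tensor.
Context {K : fieldType} {U V : lmodType K}.

Definition tensor_relb (s t : seq (U * V)) : bool := `[< tensor_rel s t >].

Lemma tensor_relb_refl : reflexive tensor_relb.
Proof. by move=> s; apply/asboolP; exact: TensorRefl. Qed.

Lemma tensor_relb_sym : symmetric tensor_relb.
Proof. by move=> s t; apply/asboolP/asboolP; exact: TensorSym. Qed.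

Lemma tensor_relb_trans : transitive tensor_relb.
Proof.
move=> t s r /asboolP st /asboolP tr.
by apply/asboolP; exact: TensorTrans st tr.
Qed.

Canonical tensor_equiv :=
  EquivRel tensor_relb tensor_relb_refl tensor_relb_sym tensor_relb_trans.

End Tensor.

Definition tensor (K : fieldType) (U V : lmodType K) : Type :=
  {eq_quot (@tensor_equiv K U V)}.

Section TensorModule.
Context {K : fieldType} {U V : lmodType K}.
Local Notation UV := (tensor U V).

HB.instance Definition _ := Choice.on UV.
HB.instance Definition _ := EqQuotient.on UV.

Definition tensor_seq (s : seq (U * V)) : UV := \pi_UV s.

Definition scale_seq (k : K) (s : seq (U * V)) : seq (U * V) :=
  [seq (k *: p.1, p.2) | p <- s].

Definition tensor_add (x y : UV) := tensor_seq (repr x ++ repr y).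
Definition tensor_scale (k : K) (x : UV) := tensor_seq (scale_seq k (repr x)).

Lemma tensor_seqP s t : tensor_seq s = tensor_seq t <-> tensor_rel s t.
Proof.
split; first by move=> /eqP; rewrite eqmodE => /asboolP.
by move=> st; apply/eqP; rewrite eqmodE; apply/asboolP.
Qed.

Lemma tensor_seqK x : tensor_seq (repr x) = x.
Proof. exact: reprK. Qed.

Lemma repr_tensor_seq s : tensor_rel (repr (tensor_seq s)) s.
Proof. by apply/tensor_seqP; rewrite tensor_seqK. Qed.

Lemma tensor_addE s t :
  tensor_add (tensor_seq s) (tensor_seq t) = tensor_seq (s ++ t).
Proof. by apply/tensor_seqP; apply: TensorCat; exact: repr_tensor_seq. Qed.

Lemma scale_seq_rel k s t :
  tensor_rel s t -> tensor_rel (scale_seq k s) (scale_seq k t).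
Proof.
rewrite /scale_seq; elim=> {s t} /=.
- by move=> s; exact: TensorRefl.
- by move=> s t _; exact: TensorSym.
- by move=> s t r _ st _; exact: TensorTrans.
- by move=> s s' t t' _ ss' _ tt'; rewrite !map_cat; exact: TensorCat.
- by move=> s t; rewrite !map_cat; exact: TensorCatC.
- by move=> u u' v; rewrite scalerDr; exact: TensorDl.
- by move=> u v v'; exact: TensorDr.
- by move=> l u v; rewrite scalerA mulrC -scalerA; exact: TensorZ.
- by move=> v; rewrite scaler0; exact: Tensor0.
Qed.

Lemma tensor_scaleE k s :
  tensor_scale k (tensor_seq s) = tensor_seq (scale_seq k s).
Proof. by apply/tensor_seqP/scale_seq_rel/repr_tensor_seq. Qed.

Lemma tensor_addA : associative tensor_add.
Proof.
move=> x y z; rewrite -[x]tensor_seqK -[y]tensor_seqK -[z]tensor_seqK.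
by rewrite !tensor_addE catA.
Qed.

Lemma tensor_addC : commutative tensor_add.
Proof. by move=> x y; apply/tensor_seqP; exact: TensorCatC. Qed.

Lemma tensor_add0 : left_id (tensor_seq [::]) tensor_add.
Proof. by move=> x; rewrite -[x]tensor_seqK tensor_addE. Qed.

Lemma scale_seq0 s : tensor_rel (scale_seq 0 s) [::].
Proof.
elim: s => [|[u v] s IHs] /=; first exact: TensorRefl.
rewrite scale0r -cat1s -[X in tensor_rel _ X]cats0.
by apply: TensorCat => //; exact: Tensor0.
Qed.

Lemma scale_seqDl k l s :
  tensor_rel (scale_seq (k + l) s) (scale_seq k s ++ scale_seq l s).
Proof.
elim: s => [|[u v] s IHs] /=; first exact: TensorRefl.
rewrite scalerDl; apply: (@TensorTrans _ _ _ _
  ([:: (k *: u, v); (l *: u, v)] ++ (scale_seq k s ++ scale_seq l s))).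
  by rewrite -cat1s; apply: TensorCat => //; exact: TensorDl.
rewrite -cat1s -[X in tensor_rel _ X]cat1s -[X in X ++ _]/([:: _] ++ [:: _]).
rewrite -catA; apply: TensorCat; first exact: TensorRefl.
rewrite -[X in tensor_rel _ (_ ++ X)]cat1s !catA; apply: TensorCat.
  exact: TensorCatC.
exact: TensorRefl.
Qed.

Lemma tensor_addN : left_inverse (tensor_seq [::]) (tensor_scale (-1)) tensor_add.
Proof.
move=> x; rewrite -[x]tensor_seqK tensor_scaleE tensor_addE.
apply/tensor_seqP; set s := repr x.
have s1 : scale_seq 1 s = s.
  by rewrite /scale_seq -[RHS]map_id; apply: eq_map => -[u v]; rewrite scale1r.
rewrite -[X in _ ++ X]s1.
apply: TensorTrans (TensorSym (scale_seqDl _ _ _)) _.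
by rewrite addNr; exact: scale_seq0.
Qed.

HB.instance Definition _ :=
  GRing.isZmodule.Build UV tensor_addA tensor_addC tensor_add0 tensor_addN.

Lemma tensorDE x y : x + y = tensor_add x y. Proof. by []. Qed.

Lemma tensor_scaleA k l x :
  tensor_scale k (tensor_scale l x) = tensor_scale (k * l) x.
Proof.
rewrite -[x]tensor_seqK !tensor_scaleE; congr tensor_seq.
by rewrite /scale_seq -map_comp; apply: eq_map => p /=; rewrite scalerA.
Qed.

Lemma tensor_scale1 : left_id 1 tensor_scale.
Proof.
move=> x; rewrite -[x]tensor_seqK tensor_scaleE; congr tensor_seq.
by rewrite /scale_seq -[RHS]map_id; apply: eq_map => -[u v]; rewrite scale1r.
Qed.

Lemma tensor_scaleDr : right_distributive tensor_scale +%R.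
Proof.
move=> k x y; rewrite -[x]tensor_seqK -[y]tensor_seqK.
rewrite !tensorDE !(tensor_addE, tensor_scaleE); congr tensor_seq.
by rewrite /scale_seq map_cat.
Qed.

Lemma tensor_scaleDl x : {morph tensor_scale^~ x : k l / k + l}.
Proof.
move=> k l; rewrite -[x]tensor_seqK.
rewrite tensorDE !tensor_scaleE !tensor_addE.
by apply/tensor_seqP; exact: scale_seqDl.
Qed.

HB.instance Definition _ := GRing.Zmodule_isLmodule.Build K UV
  tensor_scaleA tensor_scale1 tensor_scaleDr tensor_scaleDl.

Lemma tensorZE k x : k *: x = tensor_scale k x. Proof. by []. Qed.

Definition ptensor (u : U) (v : V) : UV := tensor_seq [:: (u, v)].

End TensorModule.

Notation "u *t v" := (ptensor u v) (at level 38, right associativity) : ring_scope.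

(* [\Sw_(u, v <- x) E u v] is Sweedler's notation: the sum of the [E u v] over a
   decomposition [x = sum u *t v].  When [E] is bilinear in [u] and [v] it does
   not depend on the decomposition, and is the value at [x] of the linear map
   induced by [E] (see [sweedlerE], [sweedler_linear] and [sweedler_unique]);
   it is only used for such [E]. *)
Definition sweedler (K : fieldType) (U V W : lmodType K)
    (E : U -> V -> W) (x : tensor U V) : W :=
  \sum_(p <- repr x) E p.1 p.2.

Notation "\Sw_ ( u , v <- x ) E" := (sweedler (fun u v => E) x)
  (at level 36, E at level 36, u name, v name, x at level 50,
   format "\Sw_ ( u ,  v  <-  x )  E") : ring_scope.

Section TensorTheory.
Context {K : fieldType} {U V W : lmodType K}.

Lemma ptensor_linearl v : linear (fun u => u *t v : tensor U V).
Proof.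
move=> k x y; rewrite tensorDE tensorZE /ptensor tensor_scaleE tensor_addE/=.
by apply/tensor_seqP; exact: TensorDl.
Qed.

Lemma ptensor_linearr u : linear (fun v => u *t v : tensor U V).
Proof.
move=> k x y; rewrite tensorDE tensorZE /ptensor tensor_scaleE tensor_addE/=.
apply/tensor_seqP; apply: TensorTrans (TensorDr _ _ _) _.
rewrite -[X in tensor_rel X]cat1s -[X in tensor_rel _ X]cat1s.
by apply: TensorCat (TensorRefl _); exact/TensorSym/TensorZ.
Qed.

Lemma ptensor_bilinear : bilinear_for *:%R *:%R (@ptensor K U V).
Proof. by split; [exact: ptensor_linearl | exact: ptensor_linearr]. Qed.

Lemma tensor_decomp (x : tensor U V) : x = \sum_(p <- repr x) p.1 *t p.2.
Proof.
rewrite -{1}[x]tensor_seqK; elim: (repr x) => [|[u v] s IHs].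
  by rewrite big_nil.
by rewrite big_cons -IHs tensorDE tensor_addE.
Qed.

Variable E : U -> V -> W.
Hypothesis E_bil : bilinear_for *:%R *:%R E.

Lemma sweedler_rel s t : tensor_rel s t ->
  \sum_(p <- s) E p.1 p.2 = \sum_(p <- t) E p.1 p.2.
Proof.
have El v : linear (E^~ v) := E_bil.1 v.
have Er u : linear (E u) := E_bil.2 u.
elim=> {s t} //=.
- by move=> s t r _ -> _ ->.
- by move=> s s' t t' _ IHs _ IHt; rewrite !big_cat/= IHs IHt.
- by move=> s t; rewrite !big_cat/= addrC.
- move=> u u' v; rewrite !big_cons !big_nil/= !addr0.
  by have := El v 1 u u'; rewrite !scale1r.
- move=> u v v'; rewrite !big_cons !big_nil/= !addr0.
  by have := Er u 1 v v'; rewrite !scale1r.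
- move=> k u v; rewrite !big_cons !big_nil/= !addr0.
  have E0l : E 0 v = 0.
    by have := El v (-1) 0 0; rewrite scaler0 add0r scaleN1r addNr.
  have E0r : E u 0 = 0.
    by have := Er u (-1) 0 0; rewrite scaler0 add0r scaleN1r addNr.
  have := El v k u 0; have := Er u k v 0.
  by rewrite !addr0 E0l E0r !addr0 => -> ->.
- move=> v; rewrite !big_cons !big_nil/= !addr0.
  by have := El v (-1) 0 0; rewrite scaler0 add0r scaleN1r addNr.
Qed.

Lemma sweedlerE u v : \Sw_(x, y <- u *t v) E x y = E u v.
Proof.
by rewrite /sweedler (sweedler_rel (repr_tensor_seq _)) big_seq1.
Qed.

Lemma sweedler_linear : linear (sweedler E).
Proof.
have Elin v : linear (E^~ v) := E_bil.1 v.
move=> k x y; rewrite -[x]tensor_seqK -[y]tensor_seqK.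
rewrite tensorDE tensorZE tensor_scaleE tensor_addE /sweedler.
rewrite !(sweedler_rel (repr_tensor_seq _)) big_cat/=; congr (_ + _).
rewrite big_map scaler_sumr; apply: eq_bigr => -[u v] _ /=.
have E0l : E 0 v = 0.
  by have := Elin v (-1) 0 0; rewrite scaler0 add0r scaleN1r addNr.
by have := Elin v k u 0; rewrite !addr0 E0l addr0.
Qed.

Lemma sweedler_unique (f : {linear tensor U V -> W}) :
  (forall u v, f (u *t v) = E u v) -> f =1 sweedler E.
Proof.
move=> fE x; rewrite {1}[x]tensor_decomp linear_sum /sweedler.
by apply: eq_bigr => p _; exact: fE.
Qed.

End TensorTheory.

Definition lin (K : fieldType) (U V : lmodType K) (f : U -> V) : Prop :=
  linear f.

Section Lin.
Context {K : fieldType}.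
Implicit Types P U V W : lmodType K.

Lemma lin_id U : lin (fun x : U => x). Proof. by []. Qed.

Lemma lin0 U V (f : U -> V) : lin f -> f 0 = 0.
Proof. by move=> /(_ (-1) 0 0); rewrite scaler0 add0r scaleN1r addNr. Qed.

Lemma linD U V (f : U -> V) : lin f -> {morph f : x y / x + y}.
Proof. by move=> flin x y; have := flin 1 x y; rewrite !scale1r. Qed.

Lemma linZ U V (f : U -> V) : lin f -> forall k, {morph f : x / k *: x}.
Proof. by move=> flin k x; have := flin k x 0; rewrite (lin0 flin) !addr0. Qed.

Lemma lin_comp P U V (f : U -> V) (h : P -> U) :
  lin f -> lin h -> lin (fun p => f (h p)).
Proof. by move=> flin hlin k x y; rewrite hlin flin. Qed.

Lemma lin_bilinear U V W (E : U -> V -> W) :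
  (forall v, lin (fun u => E u v)) -> (forall u, lin (fun v => E u v)) ->
  bilinear_for *:%R *:%R E.
Proof. by []. Qed.

Lemma lin_sw_arg P U V W (E : U -> V -> W) (h : P -> tensor U V) :
  bilinear_for *:%R *:%R E -> lin h -> lin (fun p => \Sw_(u, v <- h p) E u v).
Proof. by move=> /sweedler_linear; exact: lin_comp. Qed.

Lemma lin_sw_param P U V W (E : P -> U -> V -> W) x :
  (forall u v, lin (fun p => E p u v)) ->
  lin (fun p => \Sw_(u, v <- x) E p u v).
Proof.
move=> Elin k p q; rewrite /sweedler scaler_sumr -big_split/=.
by apply: eq_bigr => i _; exact: Elin.
Qed.

Lemma lin_scale P V (v : V) (h : P -> K^o) : lin h -> lin (fun p => (h p : K) *: v).
Proof. by move=> hlin k p q; rewrite hlin scalerDl scalerA. Qed.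

Lemma lin_scaler P V k (h : P -> V) : lin h -> lin (fun p => k *: h p).
Proof. by move=> hlin l p q; rewrite hlin scalerDr !scalerA mulrC. Qed.

Lemma lin_sweedler U V W W' (f : W -> W') (E : U -> V -> W) x :
  lin f -> f (\Sw_(u, v <- x) E u v) = \Sw_(u, v <- x) f (E u v).
Proof.
move=> flin; rewrite /sweedler; elim: (repr x) => [|p s IHs].
  by rewrite !big_nil (lin0 flin).
by rewrite !big_cons (linD flin) IHs.
Qed.

Lemma eq_sweedler U V W (E E' : U -> V -> W) x :
  (forall u v, E u v = E' u v) -> \Sw_(u, v <- x) E u v = \Sw_(u, v <- x) E' u v.
Proof. by move=> EE'; apply: eq_bigr => p _; exact: EE'. Qed.

Lemma exchange_sweedler U V U' V' W (E : U -> V -> U' -> V' -> W) x y :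
  \Sw_(u, v <- x) \Sw_(u', v' <- y) E u v u' v'
  = \Sw_(u', v' <- y) \Sw_(u, v <- x) E u v u' v'.
Proof. exact: exchange_big. Qed.

Lemma exchange_sweedler2 U V U' V' U1 V1 W
    (E : U -> V -> U' -> V' -> U1 -> V1 -> W) x y z :
  \Sw_(u, v <- x) \Sw_(u', v' <- y u v) \Sw_(u1, v1 <- z) E u v u' v' u1 v1
  = \Sw_(u1, v1 <- z) \Sw_(u, v <- x) \Sw_(u', v' <- y u v) E u v u' v' u1 v1.
Proof.
by rewrite exchange_sweedler; apply: eq_sweedler => u v; rewrite exchange_sweedler.
Qed.

Lemma tensor_ext U V W (f g : tensor U V -> W) : lin f -> lin g ->
  (forall u v, f (u *t v) = g (u *t v)) -> forall x, f x = g x.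
Proof.
move=> flin glin fg x; rewrite [x]tensor_decomp.
elim: (repr x) => [|p s IHs]; first by rewrite big_nil (lin0 flin) (lin0 glin).
by rewrite big_cons (linD flin) (linD glin) fg IHs.
Qed.

Lemma lin_ptensorl P U V (v : V) (h : P -> U) : lin h -> lin (fun p => h p *t v).
Proof. exact: (lin_comp (ptensor_linearl _)). Qed.

Lemma lin_ptensorr P U V (u : U) (h : P -> V) : lin h -> lin (fun p => u *t h p).
Proof. exact: (lin_comp (ptensor_linearr _)). Qed.

Lemma ptensorZr U V k (u : U) (v : V) : u *t (k *: v) = k *: (u *t v).
Proof. by rewrite (linZ (ptensor_linearr u)). Qed.

Lemma ptensorZl U V k (u : U) (v : V) : (k *: u) *t v = k *: (u *t v).
Proof. by rewrite (linZ (ptensor_linearl v)). Qed.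

Lemma lin_mull P (A : algType K) (a : A) (h : P -> A) :
  lin h -> lin (fun p => h p * a).
Proof. by move=> hlin k x y; rewrite hlin mulrDl scalerAl. Qed.

Lemma lin_mulr P (A : algType K) (a : A) (h : P -> A) :
  lin h -> lin (fun p => a * h p).
Proof. by move=> hlin k x y; rewrite hlin mulrDr scalerAr. Qed.

End Lin.
Arguments lin_id {K U}.

(* The (n+1)-st tensor power of [V], bracketed to the right. *)
Fixpoint tpow (K : fieldType) (V : lmodType K) (n : nat) : lmodType K :=
  if n is n'.+1 then tensor V (tpow V n') else V.

(* [x *t s_0 *t ... *t s_(n-1) *t y] *)
Fixpoint edged (K : fieldType) (V : lmodType K) (n : nat) :
    V -> ('I_n -> V) -> V -> tpow V n.+1 :=
  match n with
  | 0 => fun x _ y => x *t y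
  | n'.+1 => fun x s y => x *t edged (s ord0) (fun i => s (lift ord0 i)) y
  end.

HB.mixin Record isBialgebra (K : fieldType) H of GRing.Algebra K H := {
  comul : H -> tensor H H;
  counit : H -> K;
  comul_is_linear : linear comul;
  counit_is_linear : scalar counit;
  comul_coassoc : forall b,
    \Sw_(b1, b2 <- comul b) \Sw_(b11, b12 <- comul b1) (b11 *t b12 *t b2)
    = \Sw_(b1, b2 <- comul b) (b1 *t comul b2);
  counit_left : forall b, \Sw_(b1, b2 <- comul b) (counit b1 *: b2) = b;
  counit_right : forall b, \Sw_(b1, b2 <- comul b) (counit b2 *: b1) = b;
  comul1 : comul 1 = 1 *t 1;
  comulM : forall b c,
    comul (b * c) = \Sw_(b1, b2 <- comul b) \Sw_(c1, c2 <- comul c)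
                      ((b1 * c1) *t (b2 * c2));
  counit1 : counit 1 = 1;
  counitM : forall b c, counit (b * c) = counit b * counit c
}.

#[short(type="bialgType")]
HB.structure Definition Bialgebra (K : fieldType) :=
  {H of isBialgebra K H & GRing.Algebra K H}.

(* In the mixin fields [comul1] and [comulM] the ring operations are those of an
   unfolded structure, which blocks rewriting; hence these restatements. *)
Lemma bialg_comul1 (K : fieldType) (H : bialgType K) :
  comul (1 : H) = 1 *t 1.
Proof. exact: comul1. Qed.

Lemma bialg_comulM (K : fieldType) (H : bialgType K) (b c : H) :
  comul (b * c) = \Sw_(b1, b2 <- comul b) \Sw_(c1, c2 <- comul c)
                    ((b1 * c1) *t (b2 * c2)).
Proof. exact: comulM. Qed.

(* The library's [algType K] requires [1 != 0].  That loses nothing for a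
   bialgebra, whose counit maps [1] to [1], but it would exclude the zero
   algebra among the module-algebras. *)
HB.mixin Record isPzAlgebra (K : fieldType) A of GRing.Lmodule K A := {
  aone : A;
  amul : A -> A -> A;
  amul_bilinear : bilinear_for *:%R *:%R amul;
  amulA : associative amul;
  amul1l : left_id aone amul;
  amul1r : right_id aone amul
}.

#[short(type="pzAlgType")]
HB.structure Definition PzAlgebra (K : fieldType) :=
  {A of isPzAlgebra K A & GRing.Lmodule K A}.

Notation "x *a y" := (amul x y) (at level 40, left associativity) : ring_scope.

HB.mixin Record isHModAlgebra (K : fieldType) (H : bialgType K) A
    of PzAlgebra K A := {
  hact : H -> A -> A;
  hact_bilinear : bilinear_for *:%R *:%R hact;
  hact1 : forall a, hact 1 a = a;
  hactM : forall b c a, hact (b * c) a = hact b (hact c a);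
  hact_amul : forall b x y,
    hact b (x *a y) = \Sw_(b1, b2 <- comul b) (hact b1 x *a hact b2 y);
  hact_aone : forall b, hact b aone = counit b *: aone
}.

#[short(type="hmodAlgType")]
HB.structure Definition HModAlgebra (K : fieldType) (H : bialgType K) :=
  {A of isHModAlgebra K H A & PzAlgebra K A}.

Section LinAlg.
Context {K : fieldType} {H : bialgType K} {A : hmodAlgType H}.
Implicit Type P : lmodType K.

Lemma lin_comul P (h : P -> H) : lin h -> lin (fun p => comul (h p)).
Proof. exact: (lin_comp (comul_is_linear)). Qed.

Lemma lin_counit P (h : P -> H) : lin h -> lin (fun p => counit (h p) : K^o).
Proof. by move=> hlin k x y; rewrite hlin counit_is_linear. Qed.

Lemma lin_amull (B : pzAlgType K) P (b : B) (h : P -> B) :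
  lin h -> lin (fun p => h p *a b).
Proof. exact: (lin_comp (amul_bilinear.1 b)). Qed.

Lemma lin_amulr (B : pzAlgType K) P (b : B) (h : P -> B) :
  lin h -> lin (fun p => b *a h p).
Proof. exact: (lin_comp (amul_bilinear.2 b)). Qed.

Lemma lin_hactl P (a : A) (h : P -> H) : lin h -> lin (fun p => hact (h p) a).
Proof. exact: (lin_comp (hact_bilinear.1 a)). Qed.

Lemma lin_hactr P (b : H) (h : P -> A) : lin h -> lin (fun p => hact b (h p)).
Proof. exact: (lin_comp (hact_bilinear.2 b)). Qed.

End LinAlg.

Ltac prove_lin_step :=
  lazymatch goal with
  | |- forall _, _ => intro
  | |- bilinear_for _ _ _ => refine (lin_bilinear _ _); intro; cbn beta
  | |- lin (fun p => p) => exact: lin_id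
  | |- lin (fun p => @sweedler ?K ?U ?V ?W (@?E p) ?x) =>
      first [ refine (@lin_sw_param K _ U V W E x _); intros ? ?; cbn beta
            | apply: lin_sw_arg ]
  | |- lin (fun p => @sweedler _ _ _ _ _ _) => apply: lin_sw_arg
  | |- lin (fun p => ptensor _ _) => first [apply: lin_ptensorr | apply: lin_ptensorl]
  | |- lin (fun p => _ * _) => first [apply: lin_mulr | apply: lin_mull]
  | |- lin (fun p => _ *a _) => first [apply: lin_amulr | apply: lin_amull]
  | |- lin (fun p => hact _ _) => first [apply: lin_hactr | apply: lin_hactl]
  | |- lin (fun p => comul _) => apply: lin_comul
  | |- lin (fun p => _ *: _) =>
      first [apply: lin_scaler | refine (lin_scale _ (lin_counit _))]
  | |- lin (fun p => _) => fail
  | |- lin ?f => change (lin (fun p => f p))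
  end.
Ltac prove_lin := repeat prove_lin_step.

Section Coassoc.
Context {K : fieldType} {H : bialgType K}.

Lemma sweedler_coassoc (W : lmodType K) (F : H -> H -> H -> W) b :
  (forall y z, lin (fun x => F x y z)) -> (forall x z, lin (fun y => F x y z)) ->
  (forall x y, lin (fun z => F x y z)) ->
  \Sw_(b1, b2 <- comul b) \Sw_(b11, b12 <- comul b1) F b11 b12 b2
  = \Sw_(b1, b2 <- comul b) \Sw_(b21, b22 <- comul b2) F b1 b21 b22.
Proof.
move=> F1 F2 F3.
pose f (t : tensor H (tensor H H)) := \Sw_(x, s <- t) \Sw_(y, z <- s) F x y z.
have flin : lin f by rewrite /f; prove_lin.
have fE x s : f (x *t s) = \Sw_(y, z <- s) F x y z.
  by rewrite /f sweedlerE//; prove_lin.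
have := congr1 f (comul_coassoc b); rewrite !(lin_sweedler _ _ flin) => fb.
under [RHS]eq_sweedler do rewrite -fE.
rewrite -fb; apply: eq_sweedler => b1 b2; rewrite (lin_sweedler _ _ flin).
by apply: eq_sweedler => x y; rewrite fE sweedlerE//; prove_lin.
Qed.

Lemma sweedler_comulM (W : lmodType K) (E : H -> H -> W) b c :
  bilinear_for *:%R *:%R E ->
  \Sw_(x, y <- comul (b * c)) E x y
  = \Sw_(b1, b2 <- comul b) \Sw_(c1, c2 <- comul c) E (b1 * c1) (b2 * c2).
Proof.
move=> Ebil; have Elin := sweedler_linear Ebil.
rewrite bialg_comulM (lin_sweedler _ _ Elin); apply: eq_sweedler => b1 b2.
rewrite (lin_sweedler _ _ Elin); apply: eq_sweedler => c1 c2.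
exact: (@sweedlerE _ H H).
Qed.

End Coassoc.

Section CrossedProduct.
Context {K : fieldType} {H : bialgType K} {A : hmodAlgType H}.

Definition crossed : Type := tensor A (tensor A H).
HB.instance Definition _ := GRing.Lmodule.on crossed.

Definition crossed_one : crossed := aone *t aone *t 1.

Definition crossed_mul (x y : crossed) : crossed :=
  \Sw_(a1, x' <- x) \Sw_(a1', b1 <- x')
  \Sw_(a2, y' <- y) \Sw_(a2', b2 <- y')
  \Sw_(c1, c23 <- comul b1) \Sw_(c2, c3 <- comul c23)
    ((a1 *a hact c1 a2) *t (hact c3 a2' *a a1') *t (c2 * b2)).

Lemma crossed_mul_bilinear : bilinear_for *:%R *:%R crossed_mul.
Proof. by rewrite /crossed_mul; prove_lin. Qed.

Lemma lin_crossedl (P : lmodType K) y (h : P -> crossed) :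
  lin h -> lin (fun p => crossed_mul (h p) y).
Proof. exact: (lin_comp (crossed_mul_bilinear.1 y)). Qed.

Lemma lin_crossedr (P : lmodType K) x (h : P -> crossed) :
  lin h -> lin (fun p => crossed_mul x (h p)).
Proof. exact: (lin_comp (crossed_mul_bilinear.2 x)). Qed.

Lemma crossed_mulE (a1 a1' : A) (b1 : H) (a2 a2' : A) (b2 : H) :
  crossed_mul (a1 *t a1' *t b1) (a2 *t a2' *t b2)
  = \Sw_(c1, c23 <- comul b1) \Sw_(c2, c3 <- comul c23)
      ((a1 *a hact c1 a2) *t (hact c3 a2' *a a1') *t (c2 * b2)).
Proof.
rewrite /crossed_mul.
rewrite sweedlerE; last by prove_lin.
rewrite sweedlerE; last by prove_lin.
rewrite sweedlerE; last by prove_lin.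
by rewrite sweedlerE; last by prove_lin.
Qed.

Lemma crossed_ext (W : lmodType K) (f g : crossed -> W) : lin f -> lin g ->
  (forall (a a' : A) (b : H), f (a *t a' *t b) = g (a *t a' *t b)) ->
  forall x, f x = g x.
Proof.
move=> flin glin fg; apply: tensor_ext => // a s.
apply: (@tensor_ext _ A H _ (fun s => f (a *t s)) (fun s => g (a *t s))) => //.
  by apply: lin_comp flin _; prove_lin.
by apply: lin_comp glin _; prove_lin.
Qed.

Lemma counit_mid (W : lmodType K) (F : H -> W) b : lin F ->
  \Sw_(b1, b2 <- comul b) F (counit b1 *: b2) = F b.
Proof. by move=> Flin; rewrite -[in RHS](counit_left b) lin_sweedler. Qed.

Lemma counit_midr (W : lmodType K) (F : H -> W) b : lin F ->
  \Sw_(b1, b2 <- comul b) F (counit b2 *: b1) = F b.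
Proof. by move=> Flin; rewrite -[in RHS](counit_right b) lin_sweedler. Qed.

Lemma crossed_mul1l : left_id crossed_one crossed_mul.
Proof.
apply: crossed_ext; [exact: (crossed_mul_bilinear.2 _) | exact: lin_id|].
move=> a a' b; rewrite /crossed_one crossed_mulE bialg_comul1.
rewrite (@sweedlerE _ H H); last by prove_lin.
rewrite bialg_comul1 (@sweedlerE _ H H); last by prove_lin.
by rewrite !hact1 amul1l amul1r mul1r.
Qed.

Lemma crossed_mul1r : right_id crossed_one crossed_mul.
Proof.
apply: crossed_ext; [exact: (crossed_mul_bilinear.1 _) | exact: lin_id|].
move=> a a' b; rewrite /crossed_one crossed_mulE.
rewrite -[RHS](@counit_mid _ (fun c => a *t a' *t c)); last by prove_lin.
apply: eq_sweedler => c1 c23.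
rewrite -[RHS](@counit_midr _ (fun c => a *t a' *t (counit c1 *: c))); last by prove_lin.
apply: eq_sweedler => c2 c3; rewrite !hact_aone mulr1.
rewrite (linZ (amul_bilinear.2 _)) (linZ (amul_bilinear.1 _)) amul1l amul1r.
by rewrite !(ptensorZl, ptensorZr).
Qed.

(* Both sides are the sum of [F b_(1) b_(2) b_(3) b_(4) b_(5)]. *)
Lemma coassoc5l (W : lmodType K) (F : H -> H -> H -> H -> H -> W) b :
  (forall y z u v, lin (fun x => F x y z u v)) ->
  (forall x z u v, lin (fun y => F x y z u v)) ->
  (forall x y u v, lin (fun z => F x y z u v)) ->
  (forall x y z v, lin (fun u => F x y z u v)) ->
  (forall x y z u, lin (fun v => F x y z u v)) ->
  \Sw_(c1, c23 <- comul b) \Sw_(c2, c3 <- comul c23)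
  \Sw_(c21, c2' <- comul c2) \Sw_(c22, c23 <- comul c2') F c1 c21 c22 c23 c3
  = \Sw_(c1, c23 <- comul b) \Sw_(c2, c3 <- comul c23)
    \Sw_(c11, c12 <- comul c1) \Sw_(c31, c32 <- comul c3) F c11 c12 c2 c31 c32.
Proof.
move=> F1 F2 F3 F4 F5.
pose G x y s := \Sw_(z, s' <- comul s) \Sw_(u, v <- comul s') F x y z u v.
transitivity (\Sw_(x, r <- comul b) \Sw_(y, s <- comul r) G x y s).
  apply: eq_sweedler => c1 c23.
  rewrite (sweedler_coassoc (F := fun y s v =>
    \Sw_(z, u <- comul s) F c1 y z u v)); [|by prove_lin..].
  apply: eq_sweedler => y s.
  by rewrite (sweedler_coassoc (F := fun z u v => F c1 y z u v)).
rewrite -(sweedler_coassoc (F := G)); [|by rewrite /G; prove_lin..].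
apply: eq_sweedler => c1 c23; rewrite exchange_sweedler.
by [].
Qed.

Lemma crossed_mulA : associative crossed_mul.
Proof.
have ll y := crossed_mul_bilinear.1 y; have lr x := crossed_mul_bilinear.2 x.
move=> x y z; move: x; apply: crossed_ext.
- exact: ll.
- exact: lin_comp (ll z) (ll y).
move=> a1 a1' b1; move: y; apply: crossed_ext.
- exact: lin_comp (lr _) (ll z).
- exact: lin_comp (ll z) (lr _).
move=> a2 a2' b2; move: z; apply: crossed_ext.
- exact: lin_comp (lr _) (lr _).
- exact: lr.
move=> a3 a3' b3.
pose F (x1 x2 x3 x4 x5 : H) : crossed :=
  \Sw_(d1, d23 <- comul b2) \Sw_(d2, d3 <- comul d23)
    ((a1 *a hact x1 a2 *a hact (x2 * d1) a3) *t
     (hact (x4 * d3) a3' *a (hact x5 a2' *a a1')) *t (x3 * d2 * b3)).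
have -> : crossed_mul (a1 *t a1' *t b1)
      (crossed_mul (a2 *t a2' *t b2) (a3 *t a3' *t b3))
    = \Sw_(c1, c23 <- comul b1) \Sw_(c2, c3 <- comul c23)
      \Sw_(c11, c12 <- comul c1) \Sw_(c31, c32 <- comul c3) F c11 c12 c2 c31 c32.
  rewrite crossed_mulE (lin_sweedler _ _ (lr _)).
  transitivity (\Sw_(d1, d23 <- comul b2) \Sw_(d2, d3 <- comul d23)
      \Sw_(c1, c23 <- comul b1) \Sw_(c2, c3 <- comul c23)
      \Sw_(c11, c12 <- comul c1) \Sw_(c31, c32 <- comul c3)
      (((a1 *a hact c11 a2 *a hact (c12 * d1) a3) *t
     (hact (c31 * d3) a3' *a (hact c32 a2' *a a1')) *t (c2 * d2 * b3)) : crossed)).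
    apply: eq_sweedler => d1 d23; rewrite (lin_sweedler _ _ (lr _)).
    apply: eq_sweedler => d2 d3; rewrite crossed_mulE.
    apply: eq_sweedler => c1 c23; apply: eq_sweedler => c2 c3.
    rewrite !hact_amul.
    rewrite (@lin_sweedler _ H H A crossed (fun t => (a1 *a t) *t _ *t _));
      last by prove_lin.
    apply: eq_sweedler => c11 c12.
    rewrite (@lin_sweedler _ H H A crossed (fun t => _ *t (t *a a1') *t _));
      last by prove_lin.
    by apply: eq_sweedler => c31 c32; rewrite !hactM !amulA mulrA.
  rewrite exchange_sweedler2; apply: eq_sweedler => c1 c23.
  rewrite exchange_sweedler2; apply: eq_sweedler => c2 c3.
  rewrite exchange_sweedler2; apply: eq_sweedler => c11 c12.
  by rewrite exchange_sweedler2.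
have -> : crossed_mul (crossed_mul (a1 *t a1' *t b1) (a2 *t a2' *t b2))
      (a3 *t a3' *t b3)
    = \Sw_(c1, c23 <- comul b1) \Sw_(c2, c3 <- comul c23)
      \Sw_(c21, c2' <- comul c2) \Sw_(c22, c23 <- comul c2')
        F c1 c21 c22 c23 c3.
  rewrite crossed_mulE (lin_sweedler _ _ (ll _)); apply: eq_sweedler => c1 c23.
  rewrite (lin_sweedler _ _ (ll _)); apply: eq_sweedler => c2 c3.
  rewrite crossed_mulE sweedler_comulM; last by prove_lin.
  apply: eq_sweedler => c21 c2'; rewrite /F [RHS]exchange_sweedler.
  apply: eq_sweedler => d1 d23; rewrite sweedler_comulM; last by prove_lin.
  apply: eq_sweedler => c22 c23'; apply: eq_sweedler => d2 d3.
  by rewrite !amulA.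
by symmetry; apply: coassoc5l; rewrite /F; prove_lin.
Qed.
HB.instance Definition _ := isPzAlgebra.Build K crossed
  crossed_mul_bilinear crossed_mulA crossed_mul1l crossed_mul1r.

End CrossedProduct.
Arguments crossed {K} H A.

Record amodule (K : fieldType) (X : pzAlgType K) := AModule {
  amod_sort :> lmodType K;
  aact : X -> amod_sort -> amod_sort;
  aact_bilinear : bilinear_for *:%R *:%R aact;
  aact1 : forall m, aact aone m = m;
  aactM : forall x y m, aact (x *a y) m = aact x (aact y m)
}.

Section AHom.
Context {K : fieldType} {X : pzAlgType K} (M N : amodule X).

Definition is_ahom (f : M -> N) : Prop :=
  linear f /\ forall x m, f (aact x m) = aact x (f m).

Definition ahom_pred : {pred M -> N} := fun f => `[< is_ahom f >].

Record ahom : Type := AHom {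
  ahom_fun :> M -> N;
  ahomP : ahom_fun \in ahom_pred
}.

HB.instance Definition _ := [isSub for ahom_fun].
HB.instance Definition _ := [Choice of ahom by <:].

Lemma ahom_submod_closed : submod_closed ahom_pred.
Proof.
have Nlin (x : X) : lin (aact x : N -> N) := (aact_bilinear N).2 x.
split.
  apply/asboolP; split=> [k m n|x m] /=; first by rewrite scaler0 addr0.
  by rewrite (lin0 (Nlin x)).
move=> k f g /asboolP[flin fX] /asboolP[glin gX]; apply/asboolP.
split=> [l m n|x m] /=.
  rewrite !fctE flin glin !scalerDr !scalerA mulrC addrACA.
  by [].
by rewrite !fctE fX gX (Nlin x).
Qed.

HB.instance Definition _ :=
  GRing.isSubmodClosed.Build K (M -> N) ahom_pred ahom_submod_closed.
HB.instance Definition _ := [SubChoice_isSubLmodule of ahom by <:].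

End AHom.

Section TensorModules.
Context {K : fieldType} {H : bialgType K} {A : hmodAlgType H}.

(* [b (a_0 *t ... *t a_n) = b_(1) a_0 *t ... *t b_(n+1) a_n] *)
Fixpoint tact n (b : H) : tpow A n -> tpow A n :=
  match n with
  | 0 => fun a => hact b a
  | n'.+1 => fun t => \Sw_(b1, b2 <- comul b) \Sw_(a, t' <- t)
                        (hact b1 a *t (tact b2 t' : tpow A n'))
  end.

(* [tmull] and [tmulr] multiply the first factor on the left, resp. the last
   factor on the right. *)
Definition tmull n (a : A) : tpow A n -> tpow A n :=
  match n with
  | 0 => fun a0 => a *a a0
  | n'.+1 => fun t => \Sw_(a0, t' <- t) ((a *a a0) *t t')
  end.

Fixpoint tmulr n (a' : A) : tpow A n -> tpow A n :=
  match n with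
  | 0 => fun a0 => a0 *a a'
  | n'.+1 => fun t => \Sw_(a0, t' <- t) (a0 *t (tmulr a' t' : tpow A n'))
  end.

(* [(a *t a' *t b)(a_0 *t ... *t a_n)
    = a (b_(1) a_0) *t b_(2) a_1 *t ... *t (b_(n+1) a_n) a'];
   for n = 0 this is [(a *t a' *t b) a_0 = a (b a_0) a']. *)
Definition crossed_act n (x : crossed H A) (t : tpow A n) : tpow A n :=
  \Sw_(a, x' <- x) \Sw_(a', b <- x') tmull a (tmulr a' (tact b t)).

Lemma tmull_bilinear n : bilinear_for *:%R *:%R (@tmull n).
Proof. by case: n => [|n]; rewrite /tmull; prove_lin. Qed.

Lemma tmulr_bilinear n : bilinear_for *:%R *:%R (@tmulr n).
Proof.
elim: n => [|n IHn] /=; first by prove_lin.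
have l t := IHn.1 t; have r a := IHn.2 a.
apply: lin_bilinear => [t|a].
  by apply: lin_sw_param => a0 t'; apply: lin_ptensorr; exact: l.
apply: (sweedler_linear (E := fun a0 t' => a0 *t (tmulr a t' : tpow A n))).
apply: lin_bilinear => [t'|a0]; first by prove_lin.
by apply: lin_ptensorr; exact: r.
Qed.

Lemma tact_bilinear n : bilinear_for *:%R *:%R (@tact n).
Proof.
elim: n => [|n IHn] /=; first by prove_lin.
have l t := IHn.1 t; have r a := IHn.2 a.
apply: lin_bilinear => [t|b].
  apply: lin_sw_arg; last by prove_lin.
  apply: lin_bilinear => [b2|b1]; apply: lin_sw_param => a t'.
    by prove_lin.
  by apply: lin_ptensorr; exact: l.
apply: lin_sw_param => b1 b2.
apply: (sweedler_linear (E := fun a t' => hact b1 a *t (tact b2 t' : tpow A n))).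
apply: lin_bilinear => [t'|a]; first by prove_lin.
by apply: lin_ptensorr; exact: r.
Qed.

Lemma lin_tmull (P : lmodType K) n {t} (h : P -> A) : lin h -> lin (fun p => @tmull n (h p) t).
Proof. exact: (lin_comp ((tmull_bilinear n).1 t)). Qed.
Lemma lin_tmullr (P : lmodType K) n {a} (h : P -> tpow A n) : lin h -> lin (fun p => tmull a (h p)).
Proof. exact: (lin_comp ((tmull_bilinear n).2 a)). Qed.
Lemma lin_tmulr (P : lmodType K) n {t} (h : P -> A) : lin h -> lin (fun p => @tmulr n (h p) t).
Proof. exact: (lin_comp ((tmulr_bilinear n).1 t)). Qed.
Lemma lin_tmulrr (P : lmodType K) n {a} (h : P -> tpow A n) : lin h -> lin (fun p => tmulr a (h p)).
Proof. exact: (lin_comp ((tmulr_bilinear n).2 a)). Qed.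
Lemma lin_tact (P : lmodType K) n {t} (h : P -> H) : lin h -> lin (fun p => @tact n (h p) t).
Proof. exact: (lin_comp ((tact_bilinear n).1 t)). Qed.
Lemma lin_tactr (P : lmodType K) n {b} (h : P -> tpow A n) : lin h -> lin (fun p => tact b (h p)).
Proof. exact: (lin_comp ((tact_bilinear n).2 b)). Qed.

Lemma tactS n b (a : A) (t : tpow A n) :
  @tact n.+1 b (a *t t) = \Sw_(b1, b2 <- comul b) (hact b1 a *t tact b2 t).
Proof.
apply: eq_sweedler => b1 b2.
apply: (sweedlerE (E := fun a t' => hact b1 a *t (tact b2 t' : tpow A n))).
apply: lin_bilinear => [t'|a'].
  by prove_lin.
by apply: lin_ptensorr; exact: lin_tactr lin_id.
Qed.

Lemma tmullS n (a0 a : A) (t : tpow A n) :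
  @tmull n.+1 a0 (a *t t) = (a0 *a a) *t t.
Proof. by rewrite /tmull sweedlerE//; prove_lin. Qed.

Lemma tmulrS n (a' a : A) (t : tpow A n) :
  @tmulr n.+1 a' (a *t t) = a *t tmulr a' t.
Proof.
apply: (sweedlerE (E := fun a t' => a *t (tmulr a' t' : tpow A n))).
apply: lin_bilinear => [t'|a0]; first by prove_lin.
by apply: lin_ptensorr; exact: lin_tmulrr lin_id.
Qed.

Lemma tpow_ext n (W : lmodType K) (f g : tpow A n.+1 -> W) : lin f -> lin g ->
  (forall (a : A) (t : tpow A n), f (a *t t) = g (a *t t)) ->
  forall t, f t = g t.
Proof. exact: tensor_ext. Qed.

Lemma tmull1 n (t : tpow A n) : tmull aone t = t.
Proof.
case: n t => [|n]; first exact: amul1l.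
apply: tpow_ext => [||a t]; [exact: lin_tmullr lin_id|exact: lin_id|].
by rewrite tmullS amul1l.
Qed.

Lemma tmulr1 n (t : tpow A n) : tmulr aone t = t.
Proof.
elim: n t => [|n IHn]; first exact: amul1r.
apply: tpow_ext => [||a t]; [exact: lin_tmulrr lin_id|exact: lin_id|].
by rewrite tmulrS IHn.
Qed.

Lemma tact1 n (t : tpow A n) : tact 1 t = t.
Proof.
elim: n t => [|n IHn]; first exact: hact1.
apply: tpow_ext => [||a t]; [exact: lin_tactr lin_id|exact: lin_id|].
rewrite tactS bialg_comul1 (@sweedlerE _ H H) ?hact1 ?IHn//.
apply: lin_bilinear => [b|b]; first by prove_lin.
by apply: lin_ptensorr; exact: lin_tact lin_id.
Qed.

Lemma tmullA n a1 a2 (t : tpow A n) : tmull (a1 *a a2) t = tmull a1 (tmull a2 t).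
Proof.
case: n t => [|n]; first by move=> t; rewrite /= amulA.
apply: tpow_ext => [||a t].
- exact: lin_tmullr lin_id.
- exact: lin_tmullr (lin_tmullr lin_id).
by rewrite !tmullS amulA.
Qed.

Lemma tmulrA n a1 a2 (t : tpow A n) : tmulr (a2 *a a1) t = tmulr a1 (tmulr a2 t).
Proof.
elim: n t => [|n IHn]; first by move=> t; rewrite /= amulA.
apply: tpow_ext => [||a t].
- exact: lin_tmulrr lin_id.
- exact: lin_tmulrr (lin_tmulrr lin_id).
by rewrite !tmulrS IHn.
Qed.

Lemma tmullr n a a' (t : tpow A n) : tmulr a' (tmull a t) = tmull a (tmulr a' t).
Proof.
case: n t => [|n]; first by move=> t; rewrite /= amulA.
apply: tpow_ext => [||a0 t].
- exact: lin_tmulrr (lin_tmullr lin_id).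
- exact: lin_tmullr (lin_tmulrr lin_id).
by rewrite tmullS !tmulrS tmullS.
Qed.

Lemma tactM n b c (t : tpow A n) : tact (b * c) t = tact b (tact c t).
Proof.
elim: n b c t => [|n IHn] b c; first by move=> t; rewrite /= hactM.
apply: tpow_ext => [||a t].
- exact: lin_tactr lin_id.
- exact: lin_tactr (lin_tactr lin_id).
rewrite !tactS (@lin_sweedler _ H H _ _ (tact b)); last exact: lin_tactr lin_id.
rewrite sweedler_comulM; last first.
  apply: lin_bilinear => b1; first by prove_lin.
  by apply: lin_ptensorr; exact: lin_tact lin_id.
rewrite exchange_sweedler; apply: eq_sweedler => c1 c2.
by rewrite tactS; apply: eq_sweedler => b1 b2; rewrite hactM IHn.
Qed.

Lemma tact_tmull n b a (t : tpow A n) :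
  tact b (tmull a t) = \Sw_(b1, b2 <- comul b) tmull (hact b1 a) (tact b2 t).
Proof.
case: n t => [|n]; first by move=> t; rewrite /= hact_amul.
apply: tpow_ext => [||a0 t].
- exact: lin_tactr (lin_tmullr lin_id).
- by apply: lin_sw_param => b1 b2; exact: lin_tmullr (lin_tactr lin_id).
rewrite tmullS tactS.
under [LHS]eq_sweedler => b1 b2.
  rewrite hact_amul (@lin_sweedler _ H H A _ (fun u => u *t tact b2 t)).
    over.
  by prove_lin.
rewrite (sweedler_coassoc (F := fun x y z => (hact x a *a hact y a0) *t tact z t)).
- apply: eq_sweedler => b1 b2; rewrite tactS.
  rewrite (@lin_sweedler _ H H _ _ (tmull _)); last exact: lin_tmullr lin_id.
  by apply: eq_sweedler => b21 b22; rewrite tmullS.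
- by prove_lin.
- by prove_lin.
- by move=> x y; apply: lin_ptensorr; exact: lin_tact lin_id.
Qed.

Lemma tact_tmulr n b a (t : tpow A n) :
  tact b (tmulr a t) = \Sw_(b1, b2 <- comul b) tmulr (hact b2 a) (tact b1 t).
Proof.
elim: n b t => [|n IHn] b; first by move=> t; rewrite /= hact_amul.
apply: tpow_ext => [||a0 t].
- exact: lin_tactr (lin_tmulrr lin_id).
- by apply: lin_sw_param => b1 b2; exact: lin_tmulrr (lin_tactr lin_id).
rewrite tmulrS tactS.
transitivity (\Sw_(b1, b2 <- comul b) \Sw_(b11, b12 <- comul b1)
                (hact b11 a0 *t tmulr (hact b2 a) (tact b12 t))).
  rewrite (sweedler_coassoc
    (F := fun x y z => hact x a0 *t tmulr (hact z a) (tact y t))).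
  - apply: eq_sweedler => b1 b2; rewrite IHn.
    rewrite (@lin_sweedler _ H H _ _ (fun u => hact b1 a0 *t u))//.
    exact: lin_ptensorr lin_id.
  - by prove_lin.
  - move=> x z; apply: lin_ptensorr; apply: lin_tmulrr.
    exact: lin_tact lin_id.
  - move=> x y; apply: lin_ptensorr; apply: lin_tmulr.
    by prove_lin.
apply: eq_sweedler => b1 b2; rewrite tactS.
rewrite (@lin_sweedler _ H H _ _ (tmulr _)); last exact: lin_tmulrr lin_id.
by apply: eq_sweedler => b11 b12; rewrite tmulrS.
Qed.

Lemma crossed_act_bilinear n : bilinear_for *:%R *:%R (@crossed_act n).
Proof.
apply: lin_bilinear => [t|x].
  apply: (sweedler_linear (E := fun a x' =>
    \Sw_(a', b <- x') tmull a (tmulr a' (tact b t)))).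
  apply: lin_bilinear => [x'|a].
    by apply: lin_sw_param => a' b; exact: lin_tmull lin_id.
  apply: (sweedler_linear (E := fun a' b => tmull a (tmulr a' (tact b t)))).
  apply: lin_bilinear => [b|a'].
    exact: lin_tmullr (lin_tmulr lin_id).
  exact: lin_tmullr (lin_tmulrr (lin_tact lin_id)).
apply: lin_sw_param => a x'; apply: lin_sw_param => a' b.
exact: lin_tmullr (lin_tmulrr (lin_tactr lin_id)).
Qed.

Lemma crossed_actE n a a' b (t : tpow A n) :
  crossed_act (a *t a' *t b) t = tmull a (tmulr a' (tact b t)).
Proof.
rewrite /crossed_act sweedlerE; last first.
  apply: lin_bilinear => [x'|a1].
    by apply: lin_sw_param => a2 c; exact: lin_tmull lin_id.
  apply: (sweedler_linear (E := fun a' b => tmull a1 (tmulr a' (tact b t)))).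
  apply: lin_bilinear => [c|a2].
    exact: lin_tmullr (lin_tmulr lin_id).
  exact: lin_tmullr (lin_tmulrr (lin_tact lin_id)).
rewrite sweedlerE//; apply: lin_bilinear => [c|a2].
  exact: lin_tmullr (lin_tmulr lin_id).
exact: lin_tmullr (lin_tmulrr (lin_tact lin_id)).
Qed.

Lemma crossed_act1 n (t : tpow A n) : crossed_act crossed_one t = t.
Proof. by rewrite crossed_actE tact1 tmulr1 tmull1. Qed.

Lemma crossed_actM n (x y : crossed H A) (t : tpow A n) :
  crossed_act (crossed_mul x y) t = crossed_act x (crossed_act y t).
Proof.
have al u := (crossed_act_bilinear n).1 u.
have ar z := (crossed_act_bilinear n).2 z.
have ml (z : crossed H A) := crossed_mul_bilinear.1 z.
have mr (z : crossed H A) := crossed_mul_bilinear.2 z.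
move: x; apply: crossed_ext.
- exact: lin_comp (al t) (ml y).
- exact: al.
move=> a1 a1' b1; move: y; apply: crossed_ext.
- exact: lin_comp (al t) (mr _).
- exact: lin_comp (ar _) (al t).
move=> a2 a2' b2; rewrite crossed_mulE.
rewrite (lin_sweedler _ _ (al t)) !crossed_actE tact_tmull.
rewrite (@lin_sweedler _ H H _ _ (fun u => tmull a1 (tmulr a1' u))); last first.
  exact: lin_tmullr (lin_tmulrr lin_id).
apply: eq_sweedler => c1 c23.
rewrite tact_tmulr (lin_sweedler _ _ (al t)).
rewrite (@lin_sweedler _ H H _ _ (fun u => tmull a1 (tmulr a1' (tmull _ u)))); last first.
  exact: lin_tmullr (lin_tmulrr (lin_tmullr lin_id)).
apply: eq_sweedler => c2 c3.
by rewrite crossed_actE tmullA tmulrA tactM tmullr.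
Qed.

Definition tpow_module n : amodule (crossed H A) :=
  AModule (crossed_act_bilinear n) (@crossed_act1 n) (@crossed_actM n).

End TensorModules.
Arguments tpow_module {K} H A n.

(* [A] is [tpow A 0], so [CH H A n] is [Hom_X(A^{(x)(n+2)}, A)]. *)
Definition CH (K : fieldType) (H : bialgType K) (A : hmodAlgType H) (n : nat) :
    lmodType K :=
  ahom (tpow_module H A n.+1) (tpow_module H A 0).
Arguments CH {K} H A n.

(* Only the spaces of arity [n >= 1] belong to the operad: nothing is required
   of [O 0], nor of compositions in which an arity is [0]. *)
Definition composition (K : fieldType) (O : nat -> lmodType K) : Type :=
  forall (k : nat) (n : 'I_k -> nat),
    O k -> (forall i, O (n i)) -> O (\sum_(i < k) n i)%N.

(* An element together with its arity: identities of the form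
   [with_arity x = with_arity y] relate elements whose arities are equal, but
   not convertible. *)
Definition with_arity (K : fieldType) (O : nat -> lmodType K) (n : nat)
    (x : O n) : {n : nat & O n} := existT (fun n => O n : Type) n x.

(* [tagnat.Rank i l : 'I_(\sum_i n i)] is [n_0 + ... + n_(i-1) + l], the [l]-th
   index of the [i]-th block. *)
Record is_operad (K : fieldType) (O : nat -> lmodType K)
    (gamma : composition O) (Id : O 1%N) : Prop := IsOperad {
  operad_linearl : forall (k : nat) (n : 'I_k -> nat) (g : forall i, O (n i)),
    (0 < k)%N -> (forall i, 0 < n i)%N ->
    linear (fun f : O k => gamma k n f g);
  operad_linearr : forall (k : nat) (n : 'I_k -> nat) (f : O k)
      (g : forall i, O (n i)) (i : 'I_k),
    (0 < k)%N -> (forall i, 0 < n i)%N ->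
    linear (fun x : O (n i) => gamma k n f (dfwith g x));
  operad_assoc : forall (k : nat) (n : 'I_k -> nat)
      (m : 'I_(\sum_(i < k) n i) -> nat)
      (f : O k) (g : forall i, O (n i)) (h : forall j, O (m j)),
    (0 < k)%N -> (forall i, 0 < n i)%N -> (forall j, 0 < m j)%N ->
    with_arity (gamma _ m (gamma k n f g) h)
    = with_arity (gamma k _ f (fun i : 'I_k =>
        gamma (n i) _ (g i) (fun l : 'I_(n i) => h (tagnat.Rank i l))));
  operad_unit : forall (k : nat) (f : O k), (0 < k)%N ->
    with_arity (gamma k (fun=> 1%N) f (fun=> Id)) = with_arity f
}.

Definition composition2 (K : fieldType) (O : nat -> lmodType K)
    (gamma : composition O) (p q : nat) (f : O 2%N) (x : O p) (y : O q) :=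
  gamma 2 _ f (fun i => projT2 (tnth [tuple with_arity x; with_arity y] i)).

Definition is_multiplication (K : fieldType) (O : nat -> lmodType K)
    (gamma : composition O) (Id : O 1%N) (m : O 2%N) : Prop :=
  with_arity (composition2 gamma m m Id) = with_arity (composition2 gamma m Id m).

(* Main.v *)
Require Import Defs.
From mathcomp Require Import all_boot all_order all_algebra.
From mathcomp Require Import boolp zify.

(* A map out of [A^{(x)(n+2)}] is determined by its values on the pure tensors
   [edged a0 a aN], and every multilinear expression in [a0, a, aN] extends to
   one: so [gamma] is the extension of its defining formula, and the operad
   identities are compared on pure tensors, where they only concern how the
   arguments are numbered.  The point is that [gamma(f; g_1, ..., g_k)] is
   X-linear.  It commutes with the multiplications at both ends because [f]
   does.  For the action of [b] in [H], coassociativity groups the iterated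
   coproduct of [b] according to the blocks fed to the [g_i]; since [b 1 =
   eps(b) 1], the action on the i-th block [a_i] is the action on the tensor
   [1 *t a_i *t 1], hence goes through [g_i], and then through [f]. *)

Set Implicit Arguments.
Unset Strict Implicit.
Unset Printing Implicit Defensive.

Import Order.Theory GRing.Theory.
Local Open Scope ring_scope.

(** * Extension of multilinear expressions to tensor powers *)

Section MultilinearLift.
Context {K : fieldType} {V W : lmodType K}.

Definition multilinear n (F : ('I_n -> V) -> W) : Prop :=
  forall s i, lin (fun v : V => F (dfwith s (i := i) v)).

Definition edged_multilinear n (F : V -> ('I_n -> V) -> V -> W) : Prop :=
  [/\ forall s y, lin (fun x => F x s y),
      forall x y, multilinear (fun s => F x s y)
    & forall x s, lin (fun y => F x s y)].

Definition fcons n (x : V) (s : 'I_n -> V) : 'I_n.+1 -> V :=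
  fun i => oapp s x (unlift ord0 i).

Lemma fcons0 n x (s : 'I_n -> V) : fcons x s ord0 = x.
Proof. by rewrite /fcons unlift_none. Qed.

Lemma fconsS n x (s : 'I_n -> V) i : fcons x s (lift ord0 i) = s i.
Proof. by rewrite /fcons liftK. Qed.

Lemma fcons_eta n (s : 'I_n.+1 -> V) :
  fcons (s ord0) (fun i => s (lift ord0 i)) = s.
Proof.
by apply: funext => i; case: (unliftP ord0 i) => [j|] ->; rewrite ?fcons0 ?fconsS.
Qed.

Lemma dfwith_fcons0 n x v (s : 'I_n -> V) :
  dfwith (fcons x s) (i := ord0) v = fcons v s.
Proof.
apply: funext => i; case: (unliftP ord0 i) => [j|] ->.
  by rewrite dfwith_out ?fconsS.
by rewrite dfwith_in fcons0.
Qed.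

Lemma dfwith_fconsS n x v (s : 'I_n -> V) i :
  dfwith (fcons x s) (i := lift ord0 i) v = fcons x (dfwith s (i := i) v).
Proof.
apply: funext => j; case: (unliftP ord0 j) => [l|] ->; last first.
  by rewrite dfwith_out ?fcons0.
rewrite fconsS; case: (eqVneq i l) => [<-|il]; first by rewrite !dfwith_in.
by rewrite !dfwith_out ?fconsS// (inj_eq lift_inj).
Qed.

Lemma edgedS n (x x' y : V) (s : 'I_n -> V) :
  edged x (fcons x' s) y = x *t edged x' s y.
Proof.
by rewrite /= fcons0; congr (x *t edged x' _ y); apply: funext => i; rewrite fconsS.
Qed.

Lemma multilinear_fcons n (F : ('I_n.+1 -> V) -> W) x :
  multilinear F -> multilinear (fun s => F (fcons x s)).
Proof.
move=> Fm s i; have := Fm (fcons x s) (lift ord0 i).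
by under eq_fun do rewrite dfwith_fconsS.
Qed.

Lemma multilinear_fcons0 n (F : ('I_n.+1 -> V) -> W) s :
  multilinear F -> lin (fun x => F (fcons x s)).
Proof.
move=> Fm; have := Fm (fcons 0 s) ord0.
by under eq_fun do rewrite dfwith_fcons0.
Qed.

(** The recursion peels off the left end; the next argument then becomes the left end of the
    remaining tensor and is put back by [fcons]. In the base case [fun=> 0] is just the empty
    family. *)
Fixpoint edged_lift n : (V -> ('I_n -> V) -> V -> W) -> tpow V n.+1 -> W :=
  match n with
  | 0 => fun F t => \Sw_(x, y <- t) F x (fun=> 0) y
  | n'.+1 => fun F t =>
      \Sw_(x, t' <- t) edged_lift (fun x' s y => F x (fcons x' s) y) t'
  end.

(** Provides linearity in the factor peeled off first, on which the lift over the remaining factors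
    depends as a parameter. *)
Lemma lin_edged_lift_param (P : lmodType K) n
    (F : P -> V -> ('I_n -> V) -> V -> W) t :
  (forall x s y, lin (fun p => F p x s y)) ->
  lin (fun p => edged_lift (F p) t).
Proof.
elim: n F t => [|n IHn] F t Flin; apply: lin_sw_param => x t'; first exact: Flin.
by apply: IHn => x' s y; exact: Flin.
Qed.

Lemma edged_multilinear_fcons n (F : V -> ('I_n.+1 -> V) -> V -> W) x :
  edged_multilinear F ->
  edged_multilinear (fun x' s y => F x (fcons x' s) y).
Proof.
move=> [Fl Fm Fr]; split=> [s y|x' y|x' s]; last exact: Fr.
  exact: (multilinear_fcons0 (F := fun s => F x s y)).
exact: (multilinear_fcons (F := fun s => F x s y)).
Qed.

Lemma lin_edged_lift n (F : V -> ('I_n -> V) -> V -> W) :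
  edged_multilinear F -> lin (edged_lift F).
Proof.
elim: n F => [|n IHn] F Fm; apply: sweedler_linear; apply: lin_bilinear.
- by move=> y; case: Fm.
- by move=> x; case: Fm.
- by move=> t; apply: lin_edged_lift_param => x' s y; case: Fm.
by move=> x; apply: IHn; exact: edged_multilinear_fcons.
Qed.

Lemma edged_liftE n (F : V -> ('I_n -> V) -> V -> W) x s y :
  edged_multilinear F -> edged_lift F (edged x s y) = F x s y.
Proof.
elim: n F x s => [|n IHn] F x s Fm.
  rewrite /= sweedlerE; last by case: Fm => Fl _ Fr; apply: lin_bilinear.
  by congr (F x _ y); apply: funext => -[].
rewrite /= (@sweedlerE _ V (tpow V n.+1) W
  (fun x t' => edged_lift (fun x' s y => F x (fcons x' s) y) t')).
  by rewrite IHn ?fcons_eta//; exact: edged_multilinear_fcons.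
apply: lin_bilinear => [t|x'].
  by apply: lin_edged_lift_param => x' s' y'; case: Fm.
by apply: lin_edged_lift; exact: edged_multilinear_fcons.
Qed.

(** Pure tensors span: [tensor_ext] peels off the first factor, and with that factor fixed the
    induction applies to the two maps of the remaining tensor. *)
Lemma edged_ext n (f g : tpow V n.+1 -> W) : lin f -> lin g ->
  (forall x s y, f (edged x s y) = g (edged x s y)) -> forall t, f t = g t.
Proof.
elim: n f g => [|n IHn] f g flin glin fg; apply: tensor_ext => // x t.
  exact: (fg x (fun=> 0) t).
apply: (IHn (fun t => f (x *t t)) (fun t => g (x *t t))).
- exact/(lin_comp flin)/lin_ptensorr/lin_id.
- exact/(lin_comp glin)/lin_ptensorr/lin_id.
by move=> x' s y; rewrite -edgedS.
Qed.

End MultilinearLift.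

Lemma edged_multilinearP (K : fieldType) (V : lmodType K) n :
  edged_multilinear (@edged K V n).
Proof.
elim: n => [|n [IHl IHm IHr]].
  by split=> [s y|x y s []|x s] //=; [exact: ptensor_linearl|exact: ptensor_linearr].
split=> [s y|x y s i|x s].
- exact: ptensor_linearl.
- rewrite -(fcons_eta s); move: (s ord0) (fun i => s (lift ord0 i)) => x' s'.
  (* Slot [ord0] is the left end of the tail, so it needs [IHl]; the other slots are inner slots of
     the tail and need [IHm]. *)
  case: (unliftP ord0 i) => [j|] -> k u v.
    by rewrite !dfwith_fconsS !edgedS; exact: (lin_ptensorr x (IHm _ _ _ _)).
  by rewrite !dfwith_fcons0 !edgedS; exact: (lin_ptensorr x (IHl _ _)).
exact/lin_ptensorr/IHr.
Qed.

(** * Iterated coproducts and their grouping into blocks *)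

Section IteratedCoproduct.
Context {K : fieldType} {H : bialgType K}.

(* [\sum F [:: b_(1); ...; b_(n)]]; the counit in arity 0 makes [isweedler_cat]
   hold for blocks that may be empty. *)
Fixpoint isweedler (W : lmodType K) n (b : H) (F : seq H -> W) : W :=
  if n is n'.+1 then
    \Sw_(b1, b2 <- comul b) isweedler n' b2 (fun s => F (b1 :: s))
  else counit b *: F [::].

Implicit Types W : lmodType K.

(** The varied entry sits at position [size s]. Only lists of length [n] are constrained, the ones
    that [isweedler n] feeds to [F]. *)
Definition seq_multilinear W n (F : seq H -> W) : Prop :=
  forall s t : seq H, (size s + size t).+1 = n -> lin (fun x : H => F (s ++ x :: t)).

Lemma seq_multilinear_cons W n (F : seq H -> W) x :
  seq_multilinear n.+1 F -> seq_multilinear n (fun s => F (x :: s)).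
Proof. by move=> Fm s t st; apply: (Fm (x :: s)); rewrite /= addSn st. Qed.

Lemma eq_isweedler W n b (F G : seq H -> W) :
  (forall s, size s = n -> F s = G s) -> isweedler n b F = isweedler n b G.
Proof.
elim: n b F G => [|n IHn] b F G FG /=; first by rewrite FG.
apply: eq_sweedler => b1 b2; apply: IHn => s sn.
by apply: FG; rewrite /= sn.
Qed.

Lemma lin_isweedler_param (P : lmodType K) W n b (F : P -> seq H -> W) :
  (forall s, size s = n -> lin (fun p => F p s)) ->
  lin (fun p => isweedler n b (F p)).
Proof.
elim: n b F => [|n IHn] b F Flin /=; first by apply: lin_scaler; exact: Flin.
apply: lin_sw_param => b1 b2; apply: IHn => s sn.
by apply: Flin; rewrite /= sn.
Qed.

Lemma lin_isweedler W n (F : seq H -> W) :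
  seq_multilinear n F -> lin (fun b => isweedler n b F).
Proof.
elim: n F => [|n IHn] F Fm /=; first exact: (lin_scale _ (lin_counit lin_id)).
apply: lin_sw_arg; last exact/lin_comul/lin_id.
apply: lin_bilinear => [b2|b1]; last by apply: IHn; exact: seq_multilinear_cons.
by apply: lin_isweedler_param => s sn; apply: (Fm [::]); rewrite /= sn.
Qed.

Lemma isweedler_lin W W' n b (f : W -> W') (F : seq H -> W) :
  lin f -> f (isweedler n b F) = isweedler n b (fun s => f (F s)).
Proof.
move=> flin; elim: n b F => [|n IHn] b F /=; first by rewrite (linZ flin).
by rewrite (lin_sweedler _ _ flin); apply: eq_sweedler => b1 b2; exact: IHn.
Qed.

(** Generalised coassociativity, by induction on [m]: an empty first group is absorbed by the counit
    axiom, and one more factor costs one use of [sweedler_coassoc]. *)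
Lemma isweedler_cat W m n b (F : seq H -> W) :
  seq_multilinear (m + n) F ->
  isweedler (m + n) b F
  = \Sw_(b1, b2 <- comul b)
      isweedler m b1 (fun s => isweedler n b2 (fun t => F (s ++ t))).
Proof.
elim: m b F => [|m IHm] b F Fm.
  rewrite add0n /= -(counit_mid b (lin_isweedler Fm)).
  by apply: eq_sweedler => b1 b2; rewrite (linZ (lin_isweedler Fm)).
rewrite addSn /=.
rewrite (sweedler_coassoc (F := fun x y z =>
  isweedler m y (fun s => isweedler n z (fun t => F (x :: s ++ t))))).
- apply: eq_sweedler => b1 b2.
  by rewrite IHm//; exact: seq_multilinear_cons.
- move=> y z; apply: lin_isweedler_param => s sm.
  apply: lin_isweedler_param => t tn.
  by apply: (Fm [::]); rewrite /= size_cat sm tn.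
- move=> x z; apply: lin_isweedler => s t st.
  apply: lin_isweedler_param => u un /=.
  under eq_fun do rewrite -catA cat_cons.
  by apply: (Fm (x :: s)); rewrite /= size_cat un addnA addSn st.
move=> x y; apply: lin_isweedler_param => s sm.
apply: lin_isweedler => t u tu.
under eq_fun do rewrite catA.
by apply: (Fm (x :: s ++ t)); rewrite /= size_cat sm -tu !addSn addnS addnA.
Qed.


(** The offset is the rank at which [tagnat.Rank i] starts, so that blocks of coefficients match
    blocks of arguments. *)
Definition block k (n : 'I_k -> nat) (u : seq H) (i : 'I_k) : seq H :=
  take (n i) (drop (\sum_(j < k | (j < i)%N) n j)%N u).

Lemma nth_block k (n : 'I_k -> nat) u (i : 'I_k) (l : 'I_(n i)) :
  nth 0 (block n u i) l = nth 0 u (tagnat.Rank i l).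
Proof. by rewrite nth_take// nth_drop tagnat.RankEsum. Qed.

Lemma block_cat0 k (n : 'I_k.+1 -> nat) s t :
  size s = n ord0 -> block n (s ++ t) ord0 = s.
Proof. by move=> sn; rewrite /block big_pred0// drop0 take_size_cat. Qed.

Lemma block_catS k (n : 'I_k.+1 -> nat) s t i :
  size s = n ord0 ->
  block n (s ++ t) (lift ord0 i) = block (fun j => n (lift ord0 j)) t i.
Proof.
move=> sn; rewrite /block big_mkcond big_ord_recl /= -big_mkcond -sn.
by rewrite addnC -drop_drop drop_size_cat.
Qed.

Lemma seq_multilinear_cat W m n (F : seq H -> W) :
  (forall t, size t = n -> seq_multilinear m (fun s => F (s ++ t))) ->
  (forall s, size s = m -> seq_multilinear n (fun t => F (s ++ t))) ->
  seq_multilinear (m + n) F.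
Proof.
(* The varied entry lies among the first [m] or the last [n]; [t], respectively [s], is cut at the
   border between the two groups. *)
move=> Fm Fn s t st; case: (ltnP (size s) m) => sm.
  rewrite -(cat_take_drop (m - (size s).+1) t).
  under eq_fun do rewrite -cat_cons catA.
  by apply: Fm; rewrite ?size_drop ?size_takel; lia.
rewrite -(cat_take_drop m s); under eq_fun do rewrite -catA.
by apply: Fn; rewrite ?size_drop ?size_takel//; lia.
Qed.

Lemma seq_multilinear_nth (V W : lmodType K) k (f : 'I_k -> H -> V)
    (F : ('I_k -> V) -> W) :
  (forall i, lin (f i)) -> multilinear F ->
  seq_multilinear k (fun u => F (fun i => f i (nth 0 u i))).
Proof.
move=> flin Fm s t st; have sk : (size s < k)%N by rewrite -st ltnS leq_addr.
(* The varied entry has index [size s]; the [0] that [v] takes there is a placeholder, overwritten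
   by [dfwith]. *)
pose j := Ordinal sk; pose v (i : 'I_k) := f i (nth 0 (s ++ 0 :: t) i).
rewrite (_ : (fun x => _) = fun x => F (dfwith v (i := j) (f j x))).
  exact: (lin_comp (Fm v j) (flin j)).
apply: funext => x; congr F; apply: funext => i.
case: (eqVneq j i) => [<-|ji]; first by rewrite dfwith_in nth_cat ltnn subnn.
rewrite dfwith_out// /v !nth_cat; case: ltnP => // si.
by rewrite -[(i - size s)%N]prednK// subn_gt0 ltn_neqAle si andbT.
Qed.

Section Blocks.
Context {V W : lmodType K}.

Lemma fcons_block k (n : 'I_k.+1 -> nat) (f : 'I_k.+1 -> seq H -> V) s t :
  size s = n ord0 ->
  (fun i => f i (block n (s ++ t) i))
  = fcons (f ord0 s)
      (fun i => f (lift ord0 i) (block (fun j => n (lift ord0 j)) t i)).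
Proof.
move=> sn; rewrite -[LHS]fcons_eta block_cat0//; congr fcons.
by apply: funext => i; rewrite block_catS.
Qed.

Lemma seq_multilinear_blocks k (n : 'I_k -> nat) (f : 'I_k -> seq H -> V)
    (F : ('I_k -> V) -> W) :
  multilinear F -> (forall i, seq_multilinear (n i) (f i)) ->
  seq_multilinear (\sum_(i < k) n i) (fun u => F (fun i => f i (block n u i))).
Proof.
elim: k n f F => [|k IHk] n f F Fm fm; first by rewrite big_ord0 => s t.
rewrite big_ord_recl; apply: seq_multilinear_cat => u un.
  move=> s t st; under eq_fun => x.
    rewrite fcons_block; last by rewrite size_cat addnS.
    over.
  apply: (@lin_comp _ _ _ _ (fun v => F (fcons v _))); last exact: fm.
  exact: multilinear_fcons0.
rewrite (_ : (fun t => _) = fun t => F (fcons (f ord0 u)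
    (fun i => f (lift ord0 i) (block (fun j => n (lift ord0 j)) t i)))).
  apply: (IHk _ (fun i => f (lift ord0 i)) _ (multilinear_fcons (f ord0 u) Fm)).
  by move=> i; exact: fm.
by apply: funext => t; rewrite fcons_block.
Qed.

(* [Delta^(N-1)] is [Delta^(k-1)] followed by [Delta^(n_i - 1)] on the i-th factor. *)
Lemma isweedler_blocks k (n : 'I_k -> nat) b (f : 'I_k -> seq H -> V)
    (h : 'I_k -> H -> V) (F : ('I_k -> V) -> W) :
  multilinear F -> (forall i, seq_multilinear (n i) (f i)) ->
  (forall i c, isweedler (n i) c (f i) = h i c) ->
  isweedler (\sum_(i < k) n i)%N b (fun u => F (fun i => f i (block n u i)))
  = isweedler k b (fun u => F (fun i => h i (nth 0 u i))).
Proof.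
elim: k n b f h F => [|k IHk] n b f h F Fm fm fh.
  by rewrite big_ord0 /=; congr (_ *: F _); apply: funext => -[].
have := seq_multilinear_blocks Fm fm.
rewrite big_ord_recl => Sm; rewrite isweedler_cat//=.
apply: eq_sweedler => b1 b2.
(* [L] collects all that is done to the value [v] of the first block. Being linear, it can be moved
   outside the iterated coproduct of [b1], where [fh] applies. *)
pose L v := isweedler k b2
  (fun u => F (fcons v (fun i => h (lift ord0 i) (nth 0 u i)))).
have Llin : lin L.
  by apply: lin_isweedler_param => u _; exact: multilinear_fcons0.
transitivity (isweedler (n ord0) b1 (fun s => L (f ord0 s))).
  apply: eq_isweedler => s sn; under eq_isweedler => t _.
    rewrite (fcons_block f _ sn).
    over.
  apply: (IHk _ _ (fun i => f (lift ord0 i)) (fun i => h (lift ord0 i))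
    (fun v => F (fcons (f ord0 s) v))) => //.
  exact: multilinear_fcons.
rewrite -(isweedler_lin _ _ _ Llin) fh; apply: eq_isweedler => u _.
by congr F; rewrite -[RHS]fcons_eta.
Qed.

End Blocks.

End IteratedCoproduct.

(** * Numbering of arguments in nested blocks *)

Lemma big_tagnat k (n : 'I_k -> nat) (P : pred 'I_(\sum_(i < k) n i)%N)
    (F : 'I_(\sum_(i < k) n i)%N -> nat) :
  (\sum_(j | P j) F j
   = \sum_(i < k) \sum_(l < n i | P (tagnat.Rank i l)) F (tagnat.Rank i l))%N.
Proof.
rewrite sig_big_dep/= (reindex _ (onW_bij _ tagnat.rank_bij)).
by apply: eq_big => p; rewrite tagnat.rankE.
Qed.

Lemma ltn_Rank k (n : 'I_k -> nat) i i' (l : 'I_(n i)) (l' : 'I_(n i')) :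
  (tagnat.Rank i l < tagnat.Rank i' l')%N
  = (i < i')%N || (i == i') && (l < l')%N.
Proof.
rewrite -[LHS]/((tagnat.Rank i l < tagnat.Rank i' l')%O) tagnat.lt_rank ltEsig /=.
rewrite !leEord; case: (ltngtP i i') => //= [i'i|/val_inj ii'].
  by rewrite -val_eqE gtn_eqF.
by case: _ / ii' in l' *; rewrite tagged_asE eqxx.
Qed.

(** A rank counts what comes before, so both sides add the sizes of the earlier outer blocks, of the
    earlier inner blocks in block [i], and [p]. *)
Lemma Rank_Rank k (n : 'I_k -> nat) (m : 'I_(\sum_(i < k) n i)%N -> nat)
    (i : 'I_k) (l : 'I_(n i)) (p : 'I_(m (tagnat.Rank i l))) :
  tagnat.Rank (tagnat.Rank i l) p
  = @tagnat.Rank _ (fun i => \sum_(l < n i) m (tagnat.Rank i l))%N i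
      (@tagnat.Rank _ (fun l => m (tagnat.Rank i l)) l p) :> nat.
Proof.
rewrite [LHS]tagnat.RankEsum [RHS]tagnat.RankEsum [X in (_ = _ + X)%N]tagnat.RankEsum.
rewrite addnA big_tagnat (bigID (fun i' : 'I_k => (i' < i)%N)).
congr (_ + _ + _)%N.
  by apply: eq_bigr => i' /= i'i; apply: eq_bigl => l'; rewrite ltn_Rank i'i.
(* Among the outer blocks not before [i], only [i] itself contributes, through its inner indices
   below [l]. *)
rewrite (bigD1 i) ?ltnn// -[RHS]addn0; congr (_ + _)%N.
  by apply: eq_bigl => l'; rewrite ltn_Rank ltnn eqxx.
apply: big1 => i' /= /andP[/negbTE i'i /negbTE i'ni]; apply: big_pred0 => l'.
by rewrite ltn_Rank i'i i'ni.
Qed.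

Lemma multilinear_blocks (K : fieldType) (U V W : lmodType K) k (n : 'I_k -> nat)
    (f : forall i, ('I_(n i) -> U) -> V) (F : ('I_k -> V) -> W) :
  multilinear F -> (forall i, multilinear (f i)) ->
  multilinear (fun s : 'I_(\sum_(i < k) n i) -> U =>
    F (fun i => f i (fun l => s (tagnat.Rank i l)))).
Proof.
(* Writing [j] as a rank shows that varying argument [j] changes only slot [l] of block [i]. *)
move=> Fm fm s j; rewrite -(tagnat.sig2K j).
move: (tagnat.sig1 j) (tagnat.sig2 j) => i l {j}.
rewrite (_ : (fun v => _) = fun v =>
  F (dfwith (fun i => f i (fun l => s (tagnat.Rank i l))) (i := i)
       (f i (dfwith (fun l => s (tagnat.Rank i l)) (i := l) v)))).
  exact: (lin_comp (Fm _ i) (fm i _ l)).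
apply: funext => v; congr F; apply: funext => i'.
case: (eqVneq i i') => [<-|ii'].
  rewrite dfwith_in; congr (f i); apply: funext => l'.
  case: (eqVneq l l') => [<-|ll']; first by rewrite !dfwith_in.
  by rewrite !dfwith_out// -val_eqE/= tagnat.eq_Rank eqxx.
rewrite dfwith_out//; congr (f i'); apply: funext => l'.
by rewrite dfwith_out// -val_eqE/= tagnat.eq_Rank (negbTE ii').
Qed.

(** * The actions on pure tensors, and X-linearity *)

Section EdgedAction.
Context {K : fieldType} {H : bialgType K} {A : hmodAlgType H}.

Lemma tmull_edged n (a x y : A) (s : 'I_n -> A) :
  tmull a (edged x s y) = edged (a *a x) s y.
Proof. by case: n s => [|n] s; rewrite tmullS. Qed.

Lemma tmulr_edged n (a x y : A) (s : 'I_n -> A) :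
  tmulr a (edged x s y) = edged x s (y *a a).
Proof.
elim: n x s => [|n IHn] x s; rewrite [LHS]tmulrS//.
by rewrite IHn.
Qed.

Lemma seq_multilinear_hact n (x y : A) (s : 'I_n -> A) :
  seq_multilinear n
    (fun u : seq H => edged x (fun i => hact (nth 0 u i) (s i)) y).
Proof.
apply: (seq_multilinear_nth (f := fun i c => hact c (s i))
  (F := fun v => edged x v y)) => [i|].
  exact/lin_hactl/lin_id.
by case: (edged_multilinearP A n).
Qed.

(** Separates the coefficients at the two ends from the inner ones, which form an iterated coproduct
    that can be grouped into blocks. *)
Lemma tact_edged n b (x y : A) (s : 'I_n -> A) :
  tact b (edged x s y)
  = \Sw_(b1, b' <- comul b) \Sw_(b2, b3 <- comul b')
      isweedler n b2 (fun u =>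
        edged (hact b1 x) (fun i => hact (nth 0 u i) (s i)) (hact b3 y)).
Proof.
elim: n b x s => [|n IHn] b x s; rewrite [LHS]tactS; apply: eq_sweedler => b1 b'.
  (* Without inner factors the middle coefficient contributes only its counit. *)
  rewrite -(@counit_mid _ _ _ (fun c => hact b1 x *t hact c y)); last by prove_lin.
  by apply: eq_sweedler => b2 b3; rewrite (linZ (hact_bilinear.1 _)) ptensorZr.
rewrite IHn (lin_sweedler _ _ (ptensor_linearr _)).
(* The induction hypothesis treats [s ord0] as a left end; coassociativity makes its coefficient
   [c1] the head of the inner list. *)
rewrite /= (sweedler_coassoc (F := fun c1 c2 c3 =>
  isweedler n c2 (fun u => edged (hact b1 x)
    (fun i => hact (nth 0 (c1 :: u) i) (s i)) (hact c3 y)))).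
- apply: eq_sweedler => c1 c'; rewrite (lin_sweedler _ _ (ptensor_linearr _)).
  by apply: eq_sweedler => c2 c3; rewrite (isweedler_lin _ _ _ (ptensor_linearr _)).
- move=> c2 c3; apply: lin_isweedler_param => u un.
  by apply: (seq_multilinear_hact _ _ _ (s := [::])); rewrite /= un.
- move=> c1 c3; apply: lin_isweedler.
  exact: (seq_multilinear_cons c1 (seq_multilinear_hact _ _ s)).
move=> c1 c2; apply: lin_isweedler_param => u _.
by apply: lin_comp (lin_hactl _ lin_id); case: (edged_multilinearP A n.+1).
Qed.

(** At both ends a coefficient acts on [aone] by its counit, and the two counit axioms then remove
    it. *)
Lemma tact_edged1 n b (s : 'I_n -> A) :
  tact b (edged aone s aone)
  = isweedler n b (fun u => edged aone (fun i => hact (nth 0 u i) (s i)) aone).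
Proof.
have Glin := lin_isweedler (seq_multilinear_hact aone aone s).
have [el _ er] := edged_multilinearP A n.
rewrite tact_edged -[RHS](counit_mid b Glin); apply: eq_sweedler => b1 b'.
rewrite (linZ Glin) -[X in _ *: X](counit_midr b' Glin).
rewrite (lin_sweedler _ _ (lin_scaler _ lin_id)).
apply: eq_sweedler => b2 b3; rewrite (linZ Glin).
rewrite !(isweedler_lin _ _ _ (lin_scaler _ lin_id)); apply: eq_isweedler => u _.
by rewrite !hact_aone (linZ (el _ _)) (linZ (er _ _)).
Qed.

Lemma CH_linear n (f : CH H A n) : lin f.
Proof. by have /asboolP[] := ahomP f. Qed.

Lemma CH_crossed n (f : CH H A n) x (t : tpow A n.+1) :
  f (crossed_act x t) = crossed_act x (f t : tpow A 0).
Proof. by have /asboolP[_ fX] := ahomP f; exact: fX. Qed.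

Lemma CH_tmull n (f : CH H A n) a (t : tpow A n.+1) : f (tmull a t) = a *a f t.
Proof.
have := CH_crossed f (a *t aone *t 1) t.
by rewrite !crossed_actE !tact1 !tmulr1.
Qed.

Lemma CH_tmulr n (f : CH H A n) a (t : tpow A n.+1) : f (tmulr a t) = f t *a a.
Proof.
have := CH_crossed f (aone *t a *t 1) t.
by rewrite !crossed_actE !tact1 !tmull1.
Qed.

Lemma CH_tact n (f : CH H A n) b (t : tpow A n.+1) : f (tact b t) = hact b (f t).
Proof.
have := CH_crossed f (aone *t aone *t b) t.
by rewrite !crossed_actE !tmull1 !tmulr1.
Qed.

(** Elements [a *t a' *t b] span the crossed product, and each acts as [tact b], then [tmulr a'],
    then [tmull a]. *)
Lemma CH_closed n (F : tpow A n.+1 -> A) : lin F ->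
  (forall a t, F (tmull a t) = a *a F t) ->
  (forall a t, F (tmulr a t) = F t *a a) ->
  (forall b t, F (tact b t) = hact b (F t)) ->
  F \in @ahom_pred _ _ (tpow_module H A n.+1) (tpow_module H A 0).
Proof.
move=> Flin Fl Fr Fh; apply/asboolP; split=> // x t /=.
move: x; apply: crossed_ext => [||a a' b].
- exact: lin_comp Flin ((crossed_act_bilinear _).1 t).
- exact: (crossed_act_bilinear 0).1.
by rewrite !crossed_actE Fl Fr Fh.
Qed.

Lemma CH_ext n (f g : CH H A n) :
  (forall a0 a aN, f (edged a0 a aN) = g (edged a0 a aN)) -> f = g.
Proof.
move=> fg; apply: val_inj; apply: funext => t /=.
by apply: edged_ext t => //; exact: CH_linear.
Qed.

(** The index types ['I_n] and ['I_m] need not be convertible, so the two families of arguments are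
    matched by the numerical value of the index. *)
Lemma CH_with_arity_ext n m (f : CH H A n) (g : CH H A m) : n = m ->
  (forall a0 (a : 'I_n -> A) (a' : 'I_m -> A) aN,
    (forall (i : 'I_n) (j : 'I_m), i = j :> nat -> a i = a' j) ->
    f (edged a0 a aN) = g (edged a0 a' aN)) ->
  with_arity f = with_arity g.
Proof.
move=> nm; case: _ / nm in g * => fg; congr (with_arity _); apply: CH_ext => a0 a aN.
by apply: fg => i j /val_inj ->.
Qed.

End EdgedAction.

(** * The composition maps *)

Section Composition.
Context {K : fieldType} {H : bialgType K} {A : hmodAlgType H}.

Section Arities.
Variables (k : nat) (n : 'I_k -> nat) (f : CH H A k) (g : forall i, CH H A (n i)).

Definition CH_comp_edged (a0 : A) (a : 'I_(\sum_(i < k) n i) -> A) (aN : A) : A :=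
  f (edged a0
       (fun i => g i (edged aone (fun l => a (tagnat.Rank i l)) aone) : A) aN).

Lemma CH_edged_multilinear m (h : CH H A m) :
  edged_multilinear (fun x s y => h (edged x s y) : A).
Proof.
have [el em er] := edged_multilinearP A m.
split=> [s y|x y s i|x s]; apply: (lin_comp (CH_linear h)).
- exact: el.
- exact: (em x y s i).
exact: er.
Qed.

Lemma CH_comp_edged_multilinear : edged_multilinear CH_comp_edged.
Proof.
have [el em er] := CH_edged_multilinear f.
split=> [s y|x y|x s]; [exact: el| |exact: er].
apply: (multilinear_blocks (f := fun i s => g i (edged aone s aone) : A)
  (F := fun v => f (edged x v y) : A)) => [|i].
  exact: em.
by have [_ gm _] := CH_edged_multilinear (g i); exact: gm.
Qed.

Definition CH_comp_fun : tpow A (\sum_(i < k) n i).+1 -> A :=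
  edged_lift CH_comp_edged.

Lemma CH_comp_funE a0 a aN :
  CH_comp_fun (edged a0 a aN) = CH_comp_edged a0 a aN.
Proof. exact: (edged_liftE _ _ _ CH_comp_edged_multilinear). Qed.

Lemma CH_comp_fun_linear : lin CH_comp_fun.
Proof. exact: lin_edged_lift CH_comp_edged_multilinear. Qed.

Lemma CH_comp_fun_tact b t : CH_comp_fun (tact b t) = hact b (CH_comp_fun t).
Proof.
move: t; apply: edged_ext => [||a0 a aN].
- exact/(lin_comp CH_comp_fun_linear)/lin_tactr/lin_id.
- exact/lin_hactr/CH_comp_fun_linear.
rewrite CH_comp_funE -[RHS]CH_tact !tact_edged.
rewrite (lin_sweedler _ _ CH_comp_fun_linear) (lin_sweedler _ _ (CH_linear f)).
apply: eq_sweedler => b1 b'.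
rewrite (lin_sweedler _ _ CH_comp_fun_linear) (lin_sweedler _ _ (CH_linear f)).
apply: eq_sweedler => b2 b3.
rewrite (isweedler_lin _ _ _ CH_comp_fun_linear) (isweedler_lin _ _ _ (CH_linear f)).
have [_ fm _] := CH_edged_multilinear f.
(* With the ends split off, one side has an iterated coproduct over all arguments and the other one
   over the values of the [g i]. *)
rewrite -(isweedler_blocks (n := n) b2
  (f := fun i s => g i (edged aone
     (fun l => hact (nth 0 s l) (a (tagnat.Rank i l))) aone) : A)
  (h := fun i c => hact c (g i (edged aone (fun l => a (tagnat.Rank i l)) aone)))
  (fm (hact b1 a0) (hact b3 aN))).
- apply: eq_isweedler => u _; rewrite CH_comp_funE; congr (f (edged _ _ _)).
  apply: funext => i; congr (g i (edged _ _ _)); apply: funext => l.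
  by rewrite nth_block.
- move=> i s t st; apply: (lin_comp (CH_linear (g i))).
  exact: seq_multilinear_hact.
move=> i c; rewrite -CH_tact tact_edged1.
by rewrite (isweedler_lin _ _ _ (CH_linear (g i))).
Qed.

Lemma CH_comp_closed :
  CH_comp_fun \in @ahom_pred _ _ (tpow_module H A (\sum_(i < k) n i).+1)
                                 (tpow_module H A 0).
Proof.
apply: CH_closed => [|a|a|]; first exact: CH_comp_fun_linear.
- apply: edged_ext => [||a0 s aN].
  + exact/(lin_comp CH_comp_fun_linear)/lin_tmullr/lin_id.
  + exact/lin_amulr/CH_comp_fun_linear.
  rewrite tmull_edged !CH_comp_funE /CH_comp_edged -CH_tmull.
  by rewrite tmull_edged.
- apply: edged_ext => [||a0 s aN].
  + exact/(lin_comp CH_comp_fun_linear)/lin_tmulrr/lin_id.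
  + exact/lin_amull/CH_comp_fun_linear.
  rewrite tmulr_edged !CH_comp_funE /CH_comp_edged -CH_tmulr.
  by rewrite tmulr_edged.
exact: CH_comp_fun_tact.
Qed.

End Arities.

Definition CH_comp : composition (CH H A) :=
  fun k n f g => AHom (CH_comp_closed f g).

Lemma CH_compE k n (f : CH H A k) (g : forall i, CH H A (n i)) a0 a aN :
  CH_comp f g (edged a0 a aN)
  = f (edged a0
         (fun i => g i (edged aone (fun l => a (tagnat.Rank i l)) aone)) aN).
Proof. exact: CH_comp_funE. Qed.

(** * The product maps, which give the identity and the multiplication *)

Fixpoint tprod n : tpow A n -> A :=
  match n with
  | 0 => fun a => a
  | n'.+1 => fun t => \Sw_(a, t' <- t) (a *a (tprod t' : A))
  end.

Lemma lin_tprod n : lin (@tprod n).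
Proof.
elim: n => [|n IHn]; first exact: lin_id.
apply: sweedler_linear; apply: lin_bilinear => x; first exact/lin_amull/lin_id.
exact/lin_amulr/IHn.
Qed.

Lemma tprodS n a (t : tpow A n) : @tprod n.+1 (a *t t) = a *a tprod t.
Proof.
rewrite /= (sweedlerE (E := fun a t' => a *a tprod t'))//.
apply: lin_bilinear => x; first exact/lin_amull/lin_id.
exact/lin_amulr/lin_tprod.
Qed.

Lemma tprod_closed n :
  @tprod n.+1 \in @ahom_pred _ _ (tpow_module H A n.+1) (tpow_module H A 0).
Proof.
apply: CH_closed => [|a|a|]; first exact: lin_tprod.
- apply: tpow_ext => [||x t].
  + exact/(lin_comp (@lin_tprod _))/lin_tmullr/lin_id.
  + exact/lin_amulr/lin_tprod.
  by rewrite tmullS !tprodS amulA.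
(* Generalising [n.+1] lets the induction start at [tprod] on a single factor, which is the identity
   map. *)
- elim: (n.+1) => // {}n IHn; apply: tpow_ext => [||x t].
  + exact/(lin_comp (@lin_tprod _))/lin_tmulrr/lin_id.
  + exact/lin_amull/lin_tprod.
  by rewrite tmulrS !tprodS IHn amulA.
elim: (n.+1) => // {}n IHn b; apply: tpow_ext => [||x t].
- exact/(lin_comp (@lin_tprod _))/lin_tactr/lin_id.
- exact/lin_hactr/lin_tprod.
rewrite tactS tprodS hact_amul (lin_sweedler _ _ (@lin_tprod n.+1)).
by apply: eq_sweedler => b1 b2; rewrite tprodS IHn.
Qed.

Definition CH_prod n : CH H A n := AHom (tprod_closed n).

Lemma CH_prod1E (x y z : A) : CH_prod 1 (x *t y *t z) = x *a y *a z.
Proof. by rewrite [LHS](@tprodS 1) (@tprodS 0) amulA. Qed.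

Lemma CH_prod2E (x y z w : A) :
  CH_prod 2 (x *t y *t z *t w) = x *a y *a z *a w.
Proof. by rewrite [LHS](@tprodS 2) (@tprodS 1) (@tprodS 0) !amulA. Qed.

(** * The operad axioms and the multiplication *)

Lemma CH_linE n c (f g : CH H A n) t : (c *: f + g) t = c *: f t + g t.
Proof. by []. Qed.

Lemma CH_is_operad : is_operad CH_comp (CH_prod 1).
Proof.
split=> [k n g _ _ c f f'|k n f g i _ _ c x x'|k n m f g h _ _ _|k f _].
- apply: CH_ext => a0 a aN; rewrite CH_compE.
  by rewrite !CH_linE !CH_compE.
- apply: CH_ext => a0 a aN.
  rewrite CH_linE !CH_compE.
  (* Replacing [g i] by [y] changes only the [i]-th argument of [f], so multilinearity of [f]
     applies. *)
  have fE y : (fun j => dfwith g (i := i) y j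
        (edged aone (fun l => a (tagnat.Rank j l)) aone) : A)
      = dfwith (fun j => g j (edged aone (fun l => a (tagnat.Rank j l)) aone))
          (i := i) (y (edged aone (fun l => a (tagnat.Rank i l)) aone)).
    apply: funext => j; case: (eqVneq i j) => [<-|ij]; first by rewrite !dfwith_in.
    by rewrite !dfwith_out.
  have [_ fm _] := CH_edged_multilinear f.
  by rewrite !fE; exact: fm.
- apply: CH_with_arity_ext; first exact: big_tagnat.
  move=> a0 a a' aN aa'; rewrite !CH_compE.
  congr (f (edged _ _ _)); apply: funext => i; rewrite !CH_compE.
  congr (g i (edged _ _ _)); apply: funext => l.
  congr (h _ (edged _ _ _)); apply: funext => p.
  by apply: aa'; exact: Rank_Rank.
apply: CH_with_arity_ext; first by rewrite sum1_card card_ord.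
move=> a0 a a' aN aa'; rewrite CH_compE.
congr (f (edged _ _ _)); apply: funext => i.
(* The identity sends [aone *t x *t aone] to [x]; as all blocks have size 1, block [i] starts at
   rank [i]. *)
rewrite [LHS]CH_prod1E amul1r amul1l; apply: aa'.
rewrite tagnat.RankEsum ord1 addn0.
by rewrite -(big_ord_widen k (fun=> 1%N)) ?sum1_card ?card_ord// ltnW.
Qed.

Lemma CH_is_multiplication : is_multiplication CH_comp (CH_prod 1) (CH_prod 2).
Proof.
apply: CH_with_arity_ext; first by rewrite !big_ord_recl !big_ord0.
move=> a0 a a' aN aa'; rewrite !CH_compE.
(* [p] and [q] compute to the arities (2, 1) and (1, 2) of the two composites; [u] and [v] are the
   arguments sorted by block. *)
pose p i :=
  projT1 (tnth [tuple with_arity (CH_prod 2); with_arity (CH_prod 1)] i).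
pose q i :=
  projT1 (tnth [tuple with_arity (CH_prod 1); with_arity (CH_prod 2)] i).
pose j1 : 'I_2 := lift ord0 ord0.
pose u (i : 'I_2) (l : 'I_(p i)) := a (@tagnat.Rank 2 p i l).
pose v (i : 'I_2) (l : 'I_(q i)) := a' (@tagnat.Rank 2 q i l).
transitivity (a0 *a (aone *a u ord0 ord0 *a u ord0 j1 *a aone)
                 *a (aone *a u j1 ord0 *a aone) *a aN).
  rewrite [LHS]CH_prod2E; congr (_ *a _ *a _ *a _).
    exact: CH_prod2E.
  exact: CH_prod1E.
transitivity (a0 *a (aone *a v ord0 ord0 *a aone)
                 *a (aone *a v j1 ord0 *a v j1 j1 *a aone) *a aN); last first.
  rewrite [RHS]CH_prod2E; congr (_ *a _ *a _ *a _).
    by symmetry; exact: CH_prod1E.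
  by symmetry; exact: CH_prod2E.
(* Both products are now flat; their three inner factors have ranks 0, 1 and 2 in either
   numbering. *)
rewrite !amul1l !amul1r !amulA; congr (_ *a _ *a _ *a _ *a _);
  by apply: aa'; rewrite !tagnat.RankEsum [X in (X + _)%N = _]big_mkcond
    [X in _ = (X + _)%N]big_mkcond !big_ord_recl !big_ord0.
Qed.

End Composition.

Theorem theorem3p4 (K : fieldType) (H : bialgType K) (A : hmodAlgType H) :
  exists (gamma : composition (CH H A)) (Id : CH H A 1) (pi : CH H A 2),
    [/\ (forall (k : nat) (n : 'I_k -> nat)
            (f : CH H A k) (g : forall i, CH H A (n i))
            (a0 : A) (a : 'I_(\sum_(i < k) n i) -> A) (aN1 : A),
          (0 < k)%N -> (forall i, 0 < n i)%N ->
          gamma k n f g (edged a0 a aN1)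
          = f (edged a0
                 (fun i => g i (edged aone (fun l => a (tagnat.Rank i l)) aone))
                 aN1)),
        (forall a0 a1 a2 : A, Id (a0 *t a1 *t a2) = a0 *a a1 *a a2),
        (forall a0 a1 a2 a3 : A,
          pi (a0 *t a1 *t a2 *t a3) = a0 *a a1 *a a2 *a a3),
        is_operad gamma Id
      & is_multiplication gamma Id pi].
Proof.
exists CH_comp, (CH_prod 1), (CH_prod 2); split.
- by move=> *; exact: CH_compE.
- exact: CH_prod1E.
- exact: CH_prod2E.
- exact: CH_is_operad.
exact: CH_is_multiplication.
Qed.
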